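(* Let $X$ admit an exponential $\phi_0$-coupling for some Borel function $\phi_0:\mathbb X\to[1,+\infty)$, let $\pi$ be its unique invariant probability measure, and assume $\phi_0\in L_1(\mathbb X,\pi)$. Assume there exists a time-reversible Markov process $X^\diamond$ (with invariant measure $\pi$) that admits an exponential $\phi$-coupling for some Borel $\phi:\mathbb X\to[1,+\infty)$ with $\phi\in L_1(\mathbb X,\pi)$. Assume also that there exists a set $\mathcal D\subset L_2=L_2(\mathbb X,\pi)$ such that (i) $\mathcal D\cap L_2^0$ is dense in $L_2^0$; (ii) $\mathcal D$ is invariant with respect to the $L_2$-semigroup corresponding to $X$; (iii) $\mathcal D$ is contained in the domains of the $L_2$-generators $A$, $A^*$ and $A^\diamond$ corresponding to $X$, $X^*$ and $X^\diamond$, respectively, and $$A^\diamond f=\tfrac12(Af+A^*f),\quad f\in\mathcal D.$$ Then $X$ satisfies $PI\left(\frac{\beta}{2}\right)$, where $\beta$ is the exponent from the definition of the exponential $\phi$-coupling for $X^\diamond$.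
   Context: $(\mathbb X,\rho)$ is a locally compact metric space. $X$ and $X^\diamond$ are time-homogeneous, stochastically continuous, strong Markov processes in $\mathbb X$ with càdlàg trajectories. A probability measure $\pi$ is invariant for a Markov process with transition function $P_t(x,dy)$ if $\int_{\mathbb X}P_t(x,\cdot)\,\pi(dx)=\pi$ for all $t\ge0$. Coupling: for probability measures $\mu,\nu$ on $\mathbb X$, a $(\mu,\nu)$-coupling for a Markov process $X$ is any two-component process $Z=(Z^1,Z^2)$ such that $Z^1$ has the law of $X$ with initial distribution $\mu$ and $Z^2$ has the law of $X$ with initial distribution $\nu$. For a Borel function $\phi:\mathbb X\to[1,+\infty)$, the process admits an exponential $\phi$-coupling (with constants $C_\phi>0$, $\beta>0$; $\beta$ is the exponent) if there is an invariant probability measure $\pi$ such that for every $x\in\mathbb X$ there is a $(\delta_x,\pi)$-coupling $Z$ with $E\big[(\phi(Z^1_t)+\phi(Z^2_t))\mathbf 1_{Z^1_t\ne Z^2_t}\big]\le C_\phi e^{-\beta t}\phi(x)$ for all $t\ge0$. The dual process $X^*$ is $X^*_t=\tilde X_{-t}$, where $(\tilde X_t)_{t\in\mathbb R}$ is the stationary Markov process with the transition function of $X$ and $\tilde X_0\sim\pi$. A process is time-reversible if its dual process has the same distribution as the process itself. $L_2$ is the complex space $L_2^{\mathbb C}(\mathbb X,\pi)$, $L_2^0=\{f\in L_2:\int f\,d\pi=0\}$. The $L_2$-semigroup of a process with transition function $P_t$ is $T_tf(x)=\int f(y)P_t(x,dy)$, and its $L_2$-generator is $Af=\lim_{t\to0+}t^{-1}(T_tf-f)$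 (limit in $L_2$), with domain the set of $f$ for which the limit exists. For $\gamma>0$, $X$ satisfies $PI(\gamma)$ if $\|T_tf\|_2\le e^{-\gamma t}\|f\|_2$ for all $t\ge0$, $f\in L_2^0$ (with $T_t$ the semigroup of $X$). *)

(* Defs.v *)
From HB Require Import structures.
From mathcomp Require Import all_boot all_order all_algebra.
From mathcomp Require Import complex.
From mathcomp Require Import all_classical all_reals all_analysis.

Set Implicit Arguments.
Unset Strict Implicit.
Unset Printing Implicit Defensive.
Import Order.TTheory GRing.Theory Num.Theory.
Import numFieldNormedType.Exports.

Local Open Scope classical_set_scope.
Local Open Scope ring_scope.

(* Metric spaces with a distinguished point: the measurable types of the
   library are pointed.  This only excludes the empty state space, which
   carries no probability measure. *)
#[short(type="pmetricType")]
HB.structure Definition PMetric (K : numDomainType) :=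
  { M of Metric K M & Pointed M }.

Notation borel X := (g_sigma_algebraType (@open X)).

(* Time is indexed by the type R; the set I of actual times is [nonneg_times]
   for one-sided processes and setT for two-sided ones. *)
Definition nonneg_times (R : realType) : set R := [set t | 0 <= t].
Arguments nonneg_times {R}.

Section processes.
Context {R : realType} {X : pmetricType R}.
Implicit Types (I : set R) (mu nu pi : probability (borel X) R).

Section one_process.
Context {d : measure_display} {Omega : measurableType d}.
Implicit Types (P : {measure set Omega -> \bar R}) (Z : R -> Omega -> borel X).

Definition is_process I Z := forall t, I t -> measurable_fun setT (Z t).

(* The sigma-algebra generated by the Z r, r in I, r <= s. *)
Definition history I Z (s : R) : set (set Omega) :=
  <<s [set E | exists r (B : set (borel X)),
         [/\ I r, r <= s, measurable B & E = Z r @^-1` B]] >>.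

Definition markov_wrt I P Z (p : R -> R.-pker (borel X) ~> (borel X)) :=
  forall (s t : R) (E : set Omega) (B : set (borel X)),
    I s -> 0 <= t -> history I Z s E -> measurable B ->
    P (E `&` Z (s + t) @^-1` B) = (\int[P]_(w in E) p t (Z s w) B)%E.

Definition stopping_time I Z (tau : Omega -> \bar R) :=
  (forall w, 0 <= tau w)%E /\
  (forall t, I t -> history I Z t [set w | tau w <= t%:E]%E).

(* tau takes values in [0, +oo], and E ranges over the events prior to tau. *)
Definition strong_markov_wrt I P Z
    (p : R -> R.-pker (borel X) ~> (borel X)) :=
  forall (tau : Omega -> \bar R) (t : R) (E : set Omega) (B : set (borel X)),
    stopping_time I Z tau -> 0 <= t ->
    measurable E ->
    (forall s, I s -> history I Z s (E `&` [set w | tau w <= s%:E]%E)) ->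
    measurable B ->
    P (E `&` [set w | (tau w < +oo)%E /\ B (Z (fine (tau w) + t) w)]) =
    (\int[P]_(w in E `&` [set w | tau w < +oo]) p t (Z (fine (tau w)) w) B)%E.

Definition cadlag (z : R -> X) :=
  (forall t, 0 <= t -> z s @[s --> t^'+] --> z t) /\
  (forall t, 0 < t -> cvg (z s @[s --> t^'-])).

(* The probability of the event is written as the integral of its indicator.
   When X is not separable the event need not be measurable, and the integral
   of the library is then its inner probability. *)
Definition stochastically_continuous P (Z : R -> Omega -> X) :=
  forall (t e : R), 0 <= t -> 0 < e ->
    (\int[P]_w (\1_[set w | e <= mdist (Z s w) (Z t w)] w)%:E)%E
      @[s --> within nonneg_times (nbhs t)] --> 0%E.

End one_process.

(* The sigma-algebra on the path space generated by the coordinates t >= 0. *)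
Definition path_measurable : set (set (R -> X)) :=
  <<s [set E | exists t (B : set (borel X)),
         [/\ 0 <= t, measurable B & E = [set z | B (z t)]]] >>.

Record markov_process := MarkovProcess {
  mp_display : measure_display ;
  mp_space : measurableType mp_display ;
  mp_path : R -> mp_space -> borel X ;
  (* mp_law x is the law of the process started at x *)
  mp_law : R.-pker (borel X) ~> mp_space ;
  mp_tf : R -> R.-pker (borel X) ~> (borel X) ;
  mp_is_process : is_process nonneg_times mp_path ;
  mp_start : forall (x : borel X) (B : set (borel X)), measurable B ->
    mp_law x (mp_path 0 @^-1` B) = \d_x B ;
  mp_tf0 : forall (x : borel X) (B : set (borel X)), measurable B ->
    mp_tf 0 x B = \d_x B ;
  mp_chapman_kolmogorov : forall (s t : R) (x : borel X) (B : set (borel X)),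
    0 <= s -> 0 <= t -> measurable B ->
    mp_tf (s + t) x B = (\int[mp_tf s x]_y mp_tf t y B)%E ;
  mp_markov : forall x : X, markov_wrt nonneg_times (mp_law x) mp_path mp_tf ;
  mp_strong_markov : forall x : X,
    strong_markov_wrt nonneg_times (mp_law x) mp_path mp_tf ;
  mp_cadlag : forall w, cadlag (mp_path ^~ w) ;
  mp_stochastically_continuous : forall x : X,
    stochastically_continuous (mp_law x) mp_path
}.

Implicit Types Y : markov_process.

(* (Z t)_{t >= 0} has the law, on path space, of Y with initial distribution
   mu. *)
Definition has_law_from Y mu {d : measure_display} {Omega : measurableType d}
    (P : probability Omega R) (Z : R -> Omega -> borel X) :=
  is_process nonneg_times Z /\
  forall E : set (R -> X), path_measurable E ->
    P [set w | E (Z ^~ w)] =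
    (\int[mu]_x mp_law Y x [set w | E ((@mp_path Y) ^~ w)])%E.

Definition invariant_measure Y pi := forall (t : R) (B : set (borel X)),
  0 <= t -> measurable B -> (\int[pi]_x mp_tf Y t x B)%E = pi B.

Definition coupling Y mu nu {d : measure_display} {Omega : measurableType d}
    (P : probability Omega R) (Z1 Z2 : R -> Omega -> borel X) :=
  has_law_from Y mu P Z1 /\ has_law_from Y nu P Z2.

(* As above, the integrand is measurable when X is separable; in general the
   library integral is the lower integral. *)
Definition exponential_coupling Y (phi : borel X -> R) (C beta : R) :=
  [/\ 0 < C, 0 < beta &
  exists2 pi : probability (borel X) R, invariant_measure Y pi &
  forall x : borel X,
  exists (d : measure_display) (Omega : measurableType d)
         (P : probability Omega R) (Z1 Z2 : R -> Omega -> borel X),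
    coupling Y (\d_x : probability (borel X) R) pi P Z1 Z2 /\
    forall t : R, 0 <= t ->
      (\int[P]_w ((phi (Z1 t w) + phi (Z2 t w)) *
                  \1_[set w | Z1 t w <> Z2 t w] w)%:E
       <= (C * expR (- (beta * t)) * phi x)%:E)%E].

(* The two-sided stationary Markov process with the transition function of Y
   and marginal pi. *)
Record stationary_version Y pi := StationaryVersion {
  sv_display : measure_display ;
  sv_space : measurableType sv_display ;
  sv_prob : probability sv_space R ;
  sv_path : R -> sv_space -> borel X ;
  sv_is_process : is_process setT sv_path ;
  sv_initial : forall B : set (borel X), measurable B ->
    sv_prob (sv_path 0 @^-1` B) = pi B ;
  sv_markov : markov_wrt setT sv_prob sv_path (mp_tf Y) ;
  (* stationarity; shifts by all h in R cover the coordinates t < 0 *)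
  sv_stationary : forall (h : R) (E : set (R -> X)), path_measurable E ->
    sv_prob [set w | E (fun t => sv_path (h + t) w)] =
    sv_prob [set w | E (sv_path ^~ w)]
}.

Definition dual_path Y pi (V : stationary_version Y pi) :
  R -> sv_space V -> borel X := fun t => @sv_path Y pi V (- t).

(* p is a transition function for the dual process; it is determined by this
   up to pi-null sets. *)
Definition dual_transition Y pi (V : stationary_version Y pi)
    (p : R -> R.-pker (borel X) ~> (borel X)) :=
  markov_wrt nonneg_times (sv_prob V) (@dual_path Y pi V) p.

Definition time_reversible Y pi :=
  exists V : stationary_version Y pi,
    has_law_from Y pi (sv_prob V) (@dual_path Y pi V).

End processes.

Arguments markov_process {R} X.

(* Elements of the complex space L_2 are represented by functions, up to
   pi-almost everywhere equality. *)
Section L2.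
Context {R : realType} {d : measure_display} {T : measurableType d}.
Implicit Types (mu : {measure set T -> \bar R}) (f g : T -> R[i]).

Definition cintegral mu f : R[i] :=
  Complex (\int[mu]_x complex.Re (f x)) (\int[mu]_x complex.Im (f x)).

Definition L2norm mu f : \bar R :=
  Lnorm mu 2%:E (fun x => (ComplexField.Normc.normc (f x))%:E).

Definition L2 mu : set (T -> R[i]) :=
  [set f | [/\ measurable_fun setT (fun x => complex.Re (f x)),
               measurable_fun setT (fun x => complex.Im (f x)) &
               (L2norm mu f < +oo)%E]].

Definition L20 mu : set (T -> R[i]) :=
  [set f | L2 mu f /\ cintegral mu f = 0].

(* The library integrals are total: the formula gives a value also on the
   pi-null set of x at which f is not P_t(x, dy)-integrable. *)
Definition semigroup (p : R -> R.-pker T ~> T) (t : R) f : T -> R[i] :=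
  fun x => cintegral (p t x) f.

(* [L2_generator mu p f g]: f is in the domain of A and A f = g. *)
Definition L2_generator mu (p : R -> R.-pker T ~> T) f g :=
  [/\ L2 mu f, L2 mu g &
    L2norm mu (fun x => ((t^-1)%:C)%C * (semigroup p t f x - f x) - g x)
      @[t --> 0^'+] --> 0%E].

Definition PI mu (p : R -> R.-pker T ~> T) (gamma : R) :=
  forall (t : R) f, 0 <= t -> L20 mu f ->
    (L2norm mu (semigroup p t f) <= (expR (- (gamma * t)))%:E * L2norm mu f)%E.

End L2.

(* Main.v *)
Require Import Defs.
From HB Require Import structures.
From mathcomp Require Import all_boot all_order all_algebra.
From mathcomp Require Import complex finmap.
From mathcomp Require Import all_classical all_reals all_analysis.
From mathcomp Require Import measurable_realfun.
From mathcomp Require Import ring lra.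

Set Implicit Arguments.
Unset Strict Implicit.
Unset Printing Implicit Defensive.
Import Order.TTheory GRing.Theory Num.Theory.
Import numFieldNormedType.Exports.

Local Open Scope classical_set_scope.
Local Open Scope ring_scope.

(* In the real Hilbert space L_2(pi), with (u, v) = \int u v dpi, write P_t,
   P*_t and Q_t for the semigroups of X, X* and Xo.

   Decay of Q_t.  For a bounded g of mean zero the coupling gives
   |Q_t g(x)| <= K e^{-beta t} (phi(x) + \int phi dpi), whence
   ||Q_t g||^2 <= K' e^{-beta t}.  Time reversibility makes Q_t self-adjoint, so
   h(t) = ||Q_t g||^2 satisfies h(t)^2 = (Q_{2t} g, g)^2 <= h(2t) h(0), and
   iterating this inequality replaces K' by ||g||^2.  Truncation extends the
   bound ||Q_t g||^2 <= e^{-beta t} ||g||^2 to all g of mean zero, and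
   differentiating it at 0 gives 2 (Ao g, g) <= - beta ||g||^2.

   Transfer to P_t.  Since P*_t is the adjoint of P_t, (A* g, g) = (A g, g), so
   (A g, g) = (Ao g, g) for g in D.  The right derivative of ||P_t f||^2 at t is
   2 (A P_t f, P_t f) <= - beta ||P_t f||^2 because P_t f is in D, and Gronwall's
   lemma gives the decay on D, hence on its closure.  Complex functions reduce
   to their real and imaginary parts. *)

(** * The real space L_2 *)

(** Since phi is only in L_1(pi), the pointwise bound on Q_t g cannot be squared and integrated. It
    is used once, the other factor being bounded by M = sup |g|: ||Q_t g||^2 <= M \int |Q_t g| dpi.
    Hence the start from bounded g, and the rate beta for the square of the norm, which is beta/2
    for the norm. The resulting K' depends on M and would not survive a passage to the closure, so
    log-convexity has to remove it before the truncation.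

    Xo enters the transfer only through the inequality 2 (Ao g, g) <= - beta ||g||^2, applied afresh
    at g = P_t f for each t; stability of D under P_t keeps this g in all three domains. Generators
    give derivatives from the right only; contractivity of P_t makes ||P_t f|| nonincreasing, which
    is the regularity that the one-sided Gronwall argument uses.

    The duality of P_t and P*_t and the symmetry of Q_t are read off two-point laws of the
    stationary processes. They are first identities between measures of sets, extended to functions
    by monotone limits. *)

Definition real_l2 {d} {T : measurableType d} {R : realType}
    (mu : {measure set T -> \bar R}) (u : T -> R) :=
  measurable_fun setT u /\ mu.-integrable setT (fun x => (u x ^+ 2)%:E).

Definition ip {d} {T : measurableType d} {R : realType}
    (mu : {measure set T -> \bar R}) (u v : T -> R) : R :=
  \int[mu]_x (u x * v x).

Section real_L2.
Context {d} {T : measurableType d} {R : realType}.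
Variable mu : {measure set T -> \bar R}.
Implicit Types u v w : T -> R.

Local Notation l2 := (real_l2 mu).
Local Notation ip := (ip mu).

Lemma ae_eq_measurable_Rintegral u v : measurable_fun setT u ->
  measurable_fun setT v -> {ae mu, forall x, u x = v x} ->
  \int[mu]_x u x = \int[mu]_x v x.
Proof.
move=> mu_ mv uv; rewrite /Rintegral; congr fine; apply: ae_eq_integral => //;
  [exact/measurable_EFinP|exact/measurable_EFinP|].
by apply: filterS uv => x /= -> _.
Qed.

Lemma l2_mul_integrable u v : l2 u -> l2 v ->
  mu.-integrable setT (fun x => (u x * v x)%:E).
Proof.
move=> [mu_ iu] [mv iv].
apply: (le_integrable measurableT _ _ (integrableD measurableT iu iv)).
- by apply/measurable_EFinP; exact: measurable_funM.
- move=> x _ /=; rewrite lee_fin.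
  rewrite [leRHS]ger0_norm ?addr_ge0 ?sqr_ge0// normrM.
  by rewrite -(real_normK (num_real (u x))) -(real_normK (num_real (v x))); nra.
Qed.

Lemma l2_of_le u w : measurable_fun setT u -> l2 w ->
  (forall x, `|u x| <= `|w x|) -> l2 u.
Proof.
move=> mu_ [mw iw] uw; split=> //.
apply: (le_integrable measurableT _ _ iw).
  by apply/measurable_EFinP; exact: measurable_funX.
by move=> x _; rewrite /= lee_fin !normrX ler_sqr ?nnegrE.
Qed.

Lemma l2Z a u : l2 u -> l2 (fun x => a * u x).
Proof.
move=> [mu_ iu]; split; first exact: measurable_funM.
have := integrableZl measurableT (a ^+ 2) iu.
by congr (integrable _ _ _); apply/funext => x; rewrite /= exprMn.
Qed.

Lemma l2D u v : l2 u -> l2 v -> l2 (fun x => u x + v x).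
Proof.
move=> hu hv; split; first exact: measurable_funD hu.1 hv.1.
have i1 := integrableD measurableT hu.2 hv.2.
have i2 := integrableZl measurableT 2 (l2_mul_integrable hu hv).
have := integrableD measurableT i1 i2.
congr (integrable _ _ _); apply/funext => x.
by rewrite /=; congr EFin; ring.
Qed.

Lemma l2B u v : l2 u -> l2 v -> l2 (fun x => u x - v x).
Proof.
move=> hu hv; have := l2D hu (l2Z (-1) hv).
by congr real_l2; apply/funext => x; rewrite mulN1r.
Qed.

Lemma ipC u v : ip u v = ip v u.
Proof. by rewrite /ip; apply: eq_Rintegral => x _; rewrite mulrC. Qed.

Lemma ipDl u v w : l2 u -> l2 v -> l2 w ->
  ip (fun x => u x + v x) w = ip u w + ip v w.
Proof.
move=> hu hv hw; rewrite /ip -RintegralD//; try exact: l2_mul_integrable.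
by apply: eq_Rintegral => x _; rewrite mulrDl.
Qed.

Lemma ipZl a u w : l2 u -> l2 w -> ip (fun x => a * u x) w = a * ip u w.
Proof.
move=> hu hw; rewrite /ip -RintegralZl//; try exact: l2_mul_integrable.
by apply: eq_Rintegral => x _; rewrite mulrA.
Qed.

Lemma ipBl u v w : l2 u -> l2 v -> l2 w ->
  ip (fun x => u x - v x) w = ip u w - ip v w.
Proof.
move=> hu hv hw; rewrite /ip -RintegralB//; try exact: l2_mul_integrable.
by apply: eq_Rintegral => x _; rewrite mulrBl.
Qed.

Lemma ipDr u v w : l2 u -> l2 v -> l2 w ->
  ip w (fun x => u x + v x) = ip w u + ip w v.
Proof. by move=> hu hv hw; rewrite ipC ipDl// !(ipC w). Qed.

Lemma ipBr u v w : l2 u -> l2 v -> l2 w ->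
  ip w (fun x => u x - v x) = ip w u - ip w v.
Proof. by move=> hu hv hw; rewrite ipC ipBl// !(ipC w). Qed.

Lemma ipZr a u w : l2 u -> l2 w -> ip w (fun x => a * u x) = a * ip w u.
Proof. by move=> hu hw; rewrite ipC ipZl// (ipC w). Qed.

Lemma ip_ge0 u : 0 <= ip u u.
Proof. by apply: Rintegral_ge0 => x _; rewrite -expr2 sqr_ge0. Qed.

Lemma ip_ae u u' v : measurable_fun setT u -> measurable_fun setT u' ->
  measurable_fun setT v -> {ae mu, forall x, u x = u' x} -> ip u v = ip u' v.
Proof.
move=> m1 m2 m3 uu'; apply: ae_eq_measurable_Rintegral.
- exact: measurable_funM.
- exact: measurable_funM.
- by apply: filterS uu' => x ->.
Qed.

Lemma nsq_ae u u' : measurable_fun setT u -> measurable_fun setT u' ->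
  {ae mu, forall x, u x = u' x} -> ip u u = ip u' u'.
Proof. by move=> m1 m2 uu'; rewrite (ip_ae m1 m2)// ipC (ip_ae m1 m2). Qed.

Lemma nsqD u v : l2 u -> l2 v ->
  ip (fun x => u x + v x) (fun x => u x + v x) =
  ip u u + 2 * ip u v + ip v v.
Proof.
move=> hu hv; have huv := l2D hu hv.
by rewrite ipDl// !ipDr// (ipC v u); ring.
Qed.

Lemma nsqZ a u : l2 u ->
  ip (fun x => a * u x) (fun x => a * u x) = a ^+ 2 * ip u u.
Proof. by move=> hu; have hau := l2Z a hu; rewrite ipZl// ipZr//; ring. Qed.

Lemma cauchy_schwarz_sqr u v : l2 u -> l2 v ->
  ip u v ^+ 2 <= ip u u * ip v v.
Proof.
move=> hu hv.
have key (a b : R) : 0 <= a ^+ 2 * ip u u + 2 * a * b * ip u v + b ^+ 2 * ip v v.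
  have := ip_ge0 (fun x => a * u x + b * v x).
  rewrite nsqD; [|exact: l2Z..].
  by rewrite !nsqZ// ipZl ?ipZr//; [|exact: l2Z]; congr (_ <= _); ring.
have u0 := ip_ge0 u; have v0 := ip_ge0 v.
(* With x = (u, u), y = (u, v), z = (v, v), the first two choices give x (xz - y^2) >= 0 and z (xz -
   y^2) >= 0, which settles the claim unless x = z = 0. In that case the choice (-y, 1) leaves -2
   y^2 >= 0. *)
have := key (ip u v) (- ip u u); have := key (- ip v v) (ip u v).
have := key 1 (- ip u v); have := key (- ip u v) 1.
move: u0 v0; move: (ip u u) (ip u v) (ip v v) => x y z x0 z0 h1 h2 h3 h4.
have [x1|x1] := ltP 0 x; first by nra.
have [z1|z1] := ltP 0 z; first by nra.
have -> : x = 0 by lra.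
have ez : z = 0 by lra.
by move: h1; rewrite ez; nra.
Qed.

Lemma cauchy_schwarz u v : l2 u -> l2 v ->
  `|ip u v| <= Num.sqrt (ip u u) * Num.sqrt (ip v v).
Proof.
move=> hu hv; rewrite -sqrtrM ?ip_ge0// -sqrtr_sqr.
by rewrite ler_sqrt ?cauchy_schwarz_sqr// mulr_ge0 ?ip_ge0.
Qed.

Lemma minkowskiD u v : l2 u -> l2 v ->
  Num.sqrt (ip (fun x => u x + v x) (fun x => u x + v x)) <=
  Num.sqrt (ip u u) + Num.sqrt (ip v v).
Proof.
move=> hu hv; rewrite -[leRHS]ger0_norm ?addr_ge0 ?sqrtr_ge0//.
rewrite -sqrtr_sqr ler_sqrt ?sqr_ge0// nsqD// sqrrD !sqr_sqrtr ?ip_ge0//.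
rewrite lerD2r lerD2l -[leRHS]mulr_natl ler_pM2l//.
exact: le_trans (ler_norm _) (cauchy_schwarz hu hv).
Qed.

Lemma minkowskiB u v : l2 u -> l2 v ->
  Num.sqrt (ip (fun x => u x - v x) (fun x => u x - v x)) <=
  Num.sqrt (ip u u) + Num.sqrt (ip v v).
Proof.
move=> hu hv; have := minkowskiD hu (l2Z (-1) hv).
rewrite nsqZ// sqrrN expr1n mul1r; congr (Num.sqrt (ip _ _) <= _);
  by apply/funext => x; rewrite mulN1r.
Qed.

End real_L2.

Section probability_L2.
Context {d} {T : measurableType d} {R : realType}.
Variables (mu : {measure set T -> \bar R}) (mu1 : mu [set: T] = 1%E).
Implicit Types u v : T -> R.

Lemma l2_cst c : real_l2 mu (fun=> c).
Proof.
split; first exact: measurable_cst.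
apply/integrableP; split; first exact: measurable_cst.
by rewrite integral_cst//= mu1 mule1 ltry.
Qed.

Lemma l2_integrable u : real_l2 mu u -> mu.-integrable setT (EFin \o u).
Proof.
move=> hu; have := l2_mul_integrable hu (l2_cst 1).
by congr (integrable _ _ _); apply/funext => x; rewrite /= mulr1.
Qed.

Lemma bounded_l2 M u : measurable_fun setT u -> (forall x, `|u x| <= M) ->
  real_l2 mu u.
Proof.
move=> mu_ uM; apply: (l2_of_le mu_ (l2_cst M)) => x.
exact: le_trans (uM x) (ler_norm _).
Qed.

Lemma Rintegral_probability_cst c : \int[mu]_x c = c.
Proof. by rewrite Rintegral_cst// mu1 mulr1. Qed.

Lemma mean_sqr_le u : real_l2 mu u -> (\int[mu]_x u x) ^+ 2 <= ip mu u u.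
Proof.
move=> hu; have := cauchy_schwarz_sqr hu (l2_cst 1).
have -> : ip mu u (fun=> 1) = \int[mu]_x u x.
  by apply: eq_Rintegral => x _; rewrite mulr1.
by rewrite /ip [X in _ * X]Rintegral_probability_cst !mulr1.
Qed.

(** Centring projects off the constants: the squared norm drops by exactly the squared mean. *)
Lemma variance_le u : real_l2 mu u ->
  ip mu (fun x => u x - \int[mu]_y u y) (fun x => u x - \int[mu]_y u y)
  <= ip mu u u.
Proof.
move=> hu; set c := \int[mu]_x u x; have hc := l2_cst c.
rewrite ipBl ?ipBr//; try exact: l2B.
have e1 : ip mu u (fun=> c) = c * c.
  by rewrite /ip -RintegralZr//; exact: l2_integrable.
have e2 : ip mu (fun=> c) (fun=> c) = c * c by exact: Rintegral_probability_cst.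
by rewrite (ipC mu (fun=> c)) e1 e2; nra.
Qed.

End probability_L2.

(** * Monotone-continuous functionals *)

Section positive_functional.
Context {d} {T : measurableType d} {R : realType}.
Local Open Scope ereal_scope.
Implicit Types (f g : T -> \bar R) (Phi Psi : (T -> \bar R) -> \bar R).

Definition nng_measurable f := measurable_fun setT f /\ forall x, 0 <= f x.

(** The properties of integration against a measure, isolated so that iterated integrals can be
    compared as functionals, without first being written as measures. *)
Definition positive_functional Phi :=
  [/\ forall f g, nng_measurable f -> nng_measurable g ->
        Phi (fun x => f x + g x) = Phi f + Phi g,
      forall (c : R) f, (0 <= c)%R -> nng_measurable f ->
        Phi (fun x => c%:E * f x) = c%:E * Phi f,
      forall f g, nng_measurable f -> nng_measurable g ->
        (forall x, f x <= g x) -> Phi f <= Phi g &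
      forall f_ : nat -> T -> \bar R, (forall n, nng_measurable (f_ n)) ->
        (forall x, nondecreasing_seq (f_ ^~ x)) ->
        Phi (fun x => limn (f_ ^~ x)) = limn (fun n => Phi (f_ n))].

(** The weight may be [+oo], and there monotonicity matters: either every [u n] vanishes and both
    sides are 0 by the convention on 0 times infinity, or all products are [+oo] from some index
    on. *)
Lemma ge0_limeMl (y : \bar R) (u : nat -> \bar R) : 0 <= y ->
  (forall n, 0 <= u n) -> nondecreasing_seq u ->
  limn (fun n => y * u n) = y * limn u.
Proof.
move=> y0 u0 nd; have cu := ereal_nondecreasing_is_cvgn nd.
case: y y0 => [r| |] y0 //; first by rewrite limeMl.
have [u0'|] := pselect (forall n, u n = 0).
  have -> : u = cst 0 by apply/funext.
  under eq_fun do rewrite mule0.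
  by rewrite !lim_cst// mule0.
move=> /existsNP[N /eqP uN]; have uN0 : 0 < u N by rewrite lt_def uN u0.
have lu : 0 < limn u.
  rewrite (cvg_lim _ (ereal_nondecreasing_cvgn nd))//.
  by apply: lt_le_trans uN0 (ereal_sup_ubound _); exists N.
rewrite gt0_mulye//; apply/cvg_lim => //; apply: cvg_near_cst.
near=> n; rewrite gt0_mulye//; apply: lt_le_trans uN0 _; apply: nd.
by near: n; exact: nbhs_infty_ge.
Unshelve. all: by end_near. Qed.

Lemma nng_measurableD f g : nng_measurable f -> nng_measurable g ->
  nng_measurable (fun x => f x + g x).
Proof.
move=> [mf f0] [mg g0]; split; first exact: emeasurable_funD.
by move=> x; rewrite adde_ge0.
Qed.

Lemma nng_measurableM f g : nng_measurable f -> nng_measurable g ->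
  nng_measurable (fun x => f x * g x).
Proof.
move=> [mf f0] [mg g0]; split; first exact: emeasurable_funM.
by move=> x; rewrite mule_ge0.
Qed.

Lemma nng_measurable_indic (A : set T) : measurable A ->
  nng_measurable (fun x => (\1_A x)%:E).
Proof.
move=> mA; split; last by move=> x; rewrite lee_fin.
by apply/measurable_EFinP; exact: measurable_indic.
Qed.

Lemma nng_measurable_cst (c : R) : (0 <= c)%R -> nng_measurable (fun=> c%:E).
Proof. by move=> c0; split=> // x; rewrite lee_fin. Qed.

Lemma positive_functional_sum Phi (I : Type) (s : seq I) (c : I -> R)
    (g : I -> T -> \bar R) : positive_functional Phi ->
  (forall i, 0 <= c i)%R -> (forall i, nng_measurable (g i)) ->
  Phi (fun x => \sum_(i <- s) (c i)%:E * g i x) =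
  \sum_(i <- s) (c i)%:E * Phi (g i).
Proof.
move=> [pD pZ _ _] c0 mg.
have nng_sum s' : nng_measurable (fun x => \sum_(i <- s') (c i)%:E * g i x).
  elim: s' => [|i s' ih].
    by under eq_fun do rewrite big_nil; exact: nng_measurable_cst.
  under eq_fun do rewrite big_cons.
  by apply: nng_measurableD => //; apply: nng_measurableM => //;
    exact: nng_measurable_cst.
elim: s => [|i s ih].
  rewrite big_nil; transitivity (Phi (fun=> 0%:E * 0%:E)).
    by congr Phi; apply/funext => x; rewrite big_nil mul0e.
  by rewrite pZ ?mul0e//; exact: nng_measurable_cst.
rewrite big_cons -ih -pZ// -pD//; last first.
  by apply: nng_measurableM => //; exact: nng_measurable_cst.
by congr Phi; apply/funext => x; rewrite big_cons.
Qed.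

Import HBNNSimple.

(** The functional form of the uniqueness of a measure given its values on sets: linearity carries
    the agreement from indicators to simple functions, and continuity along increasing sequences to
    all of their limits. *)
Lemma positive_functional_ext Phi Psi : positive_functional Phi ->
  positive_functional Psi ->
  (forall A, measurable A ->
     Phi (fun x => (\1_A x)%:E) = Psi (fun x => (\1_A x)%:E)) ->
  forall f, nng_measurable f -> Phi f = Psi f.
Proof.
move=> pPhi pPsi indic f [mf f0].
pose f_ := nnsfun_approx measurableT mf.
have nf_ n : nng_measurable (EFin \o f_ n).
  split; last by move=> x; rewrite lee_fin.
  exact/measurable_EFinP.
have nd x : nondecreasing_seq (fun n => (EFin \o f_ n) x).
  move=> m n mn; rewrite /= lee_fin.
  by have /asboolP := nd_nnsfun_approx measurableT mf mn; exact.
have fE : f = (fun x => limn (fun n => (EFin \o f_ n) x)).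
  apply/funext => x; apply/esym/cvg_lim => //.
  exact: cvg_nnsfun_approx.
have eq_sfun (h : {nnsfun T >-> R}) : Phi (EFin \o h) = Psi (EFin \o h).
  (* [Num.max r 0] equals [r] on the range of [h]; it makes the coefficient nonnegative for every
     real [r], as [positive_functional_sum] asks. *)
  have hE : EFin \o h = (fun x => \sum_(r <- fset_set (range h))
      (Num.max r 0)%R%:E * (\1_(h @^-1` [set r]) x)%:E).
    apply/funext => x; rewrite /= fimfunE fsbig_finite//=.
    rewrite -sumEFin big_seq [RHS]big_seq; apply: eq_bigr => r.
    rewrite in_fset_set; last exact: fimfunP.
    move=> /set_mem[y _ <-].
    by rewrite max_l// EFinM.
  have m_ r : nng_measurable (fun x => (\1_(h @^-1` [set r]) x)%:E : \bar R).
    by apply: nng_measurable_indic; exact: measurable_sfunP.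
  rewrite hE !positive_functional_sum//; try by move=> r; rewrite le_max lexx orbT.
  by apply: eq_bigr => r _; rewrite indic//; exact: measurable_sfunP.
case: pPhi => _ _ _ lPhi; case: pPsi => _ _ _ lPsi.
rewrite fE lPhi// lPsi//.
by congr (limn _); apply/funext => n; exact: eq_sfun.
Qed.

End positive_functional.

Section positive_functional_integral.
Context {d d'} {T : measurableType d} {U : measurableType d'} {R : realType}.
Local Open Scope ereal_scope.

Lemma positive_functional_integral (mu : {measure set T -> \bar R})
    (w : T -> \bar R) : nng_measurable w ->
  positive_functional (fun f => \int[mu]_x (w x * f x)).
Proof.
move=> [mw w0]; split.
- move=> f g [mf f0] [mg g0]; rewrite -ge0_integralD//.
  + by apply: eq_integral => x _; rewrite ge0_muleDr.
  + by move=> x _; rewrite mule_ge0.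
  + exact: emeasurable_funM.
  + by move=> x _; rewrite mule_ge0.
  + exact: emeasurable_funM.
- move=> c f c0 [mf f0]; rewrite -ge0_integralZl_EFin//.
  + by apply: eq_integral => x _; rewrite muleCA.
  + by move=> x _; rewrite mule_ge0.
  + exact: emeasurable_funM.
- move=> f g [mf f0] [mg g0] fg; apply: ge0_le_integral => //.
  + by move=> x _; rewrite mule_ge0.
  + exact: emeasurable_funM.
  + exact: emeasurable_funM.
  + by move=> x _; rewrite lee_wpmul2l.
- move=> f_ nf nd; rewrite -monotone_convergence//.
  + apply: eq_integral => x _; rewrite ge0_limeMl// => n.
    by case: (nf n).
  + by move=> n; apply: emeasurable_funM => //; case: (nf n).
  + by move=> n x _; rewrite mule_ge0//; case: (nf n).
  + by move=> x _ m n mn; rewrite lee_wpmul2l//; exact: nd.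
Qed.

Lemma positive_functional_comp (Phi : (U -> \bar R) -> \bar R)
    (K : (T -> \bar R) -> U -> \bar R) : positive_functional Phi ->
  (forall y, positive_functional (K ^~ y)) ->
  (forall f, nng_measurable f -> nng_measurable (K f)) ->
  positive_functional (Phi \o K).
Proof.
move=> [pD pZ pM pL] pK nK; split => /=.
- move=> f g nf ng; rewrite -pD; try exact: nK.
  by congr Phi; apply/funext => y; case: (pK y) => h _ _ _; exact: h.
- move=> c f c0 nf; rewrite -pZ//; last exact: nK.
  by congr Phi; apply/funext => y; case: (pK y) => _ h _ _; exact: h.
- move=> f g nf ng fg; apply: pM; try exact: nK.
  by move=> y; case: (pK y) => _ _ h _; exact: h.
- move=> f_ nf nd; rewrite -pL//.
  + by congr Phi; apply/funext => y; case: (pK y) => _ _ _ h; exact: h.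
  + by move=> n; exact: nK.
  + move=> y m n mn; case: (pK y) => _ _ h _; apply: h => //.
    by move=> x; exact: nd.
Qed.

End positive_functional_integral.

(** * Kernels acting on functions *)

(* The value is the junk of [Rintegral] at the null set of [x] where [u] is not
   [k x]-integrable. *)
Definition kernel_op {d} {T : measurableType d} {R : realType}
    (k : R.-pker T ~> T) (u : T -> R) : T -> R := fun x => \int[k x]_y u y.

Section kernel_op.
Context {d} {T : measurableType d} {R : realType}.
Implicit Types (k p q : R.-pker T ~> T) (u v : T -> R).
Implicit Types mu nu : {measure set T -> \bar R}.

Lemma kernel_nng k (B : set T) : measurable B -> nng_measurable (k ^~ B).
Proof. by move=> mB; split=> //; exact: measurable_kernel. Qed.

Lemma kernel_integral_nng k (f : T -> \bar R) : nng_measurable f ->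
  nng_measurable (fun x => \int[k x]_y f y)%E.
Proof.
move=> [mf f0]; split; last by move=> x; exact: integral_ge0.
by apply: measurable_fun_integral_kernel => // U mU; exact: measurable_kernel.
Qed.

Lemma positive_functional_measure mu :
  positive_functional (fun f => \int[mu]_x f x)%E.
Proof.
have := positive_functional_integral mu (nng_measurable_cst (@ler01 R)).
congr positive_functional; apply/funext => f.
by apply: eq_integral => x _; rewrite mul1e.
Qed.

Lemma positive_functional_kernel mu (w : T -> \bar R) k : nng_measurable w ->
  positive_functional (fun f => \int[mu]_x (w x * \int[k x]_y f y))%E.
Proof.
move=> nw; have := positive_functional_comp (positive_functional_integral mu nw)
  (K := fun f x => \int[k x]_y f y)%E; apply.
- by move=> x; exact: positive_functional_measure.
- by move=> f nf; exact: kernel_integral_nng.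
Qed.

Lemma ge0_integral_kernel mu nu k :
  (forall B, measurable B -> \int[mu]_x k x B = nu B)%E ->
  forall f, nng_measurable f -> (\int[nu]_x f x = \int[mu]_x \int[k x]_y f y)%E.
Proof.
move=> munu f nf.
have pk := positive_functional_kernel mu k (nng_measurable_cst (@ler01 R)).
rewrite (positive_functional_ext (positive_functional_measure nu) pk _ nf).
  by apply: eq_integral => x _; rewrite mul1e.
move=> A mA; rewrite integral_indic// setIT -munu//.
by apply: eq_integral => x _; rewrite mul1e integral_indic// setIT.
Qed.

Lemma kernel_op_measurable k u : measurable_fun setT u ->
  measurable_fun setT (kernel_op k u).
Proof.
move=> mu_; rewrite /kernel_op /Rintegral.
apply: measurableT_comp => //.
under eq_fun do rewrite integralE.
have m1 : measurable_fun setT (EFin \o u) by exact/measurable_EFinP.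
apply: emeasurable_funB.
- by apply: (kernel_integral_nng k _).1; split; [exact: measurable_funepos|].
- by apply: (kernel_integral_nng k _).1; split; [exact: measurable_funeneg|].
Qed.

Section composition.
Variables (mu nu : {measure set T -> \bar R}) (k : R.-pker T ~> T).
Hypothesis munu : forall B, measurable B -> (\int[mu]_x k x B = nu B)%E.

Lemma kernel_comp_integral_abs u : nu.-integrable setT (EFin \o u) ->
  (\int[mu]_x \int[k x]_y `|(u y)%:E| < +oo)%E.
Proof.
case/integrableP => mu_ iu; rewrite -(ge0_integral_kernel munu)//; split=> //.
exact: measurableT_comp.
Qed.

Lemma kernel_comp_ae_integrable u : nu.-integrable setT (EFin \o u) ->
  {ae mu, forall x, (k x).-integrable setT (EFin \o u)}.
Proof.
move=> iu; have [mu_ _] := integrableP _ _ _ iu.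
have n1 : nng_measurable (fun y => `|(u y)%:E|)%E.
  by split=> //; exact: measurableT_comp.
have [mF F0] := kernel_integral_nng k n1.
have : mu.-integrable setT (fun x => \int[k x]_y `|(u y)%:E|)%E.
  apply/integrableP; split=> //; under eq_integral do rewrite gee0_abs//.
  exact: kernel_comp_integral_abs.
move=> /(integrable_ae measurableT); apply: filterS => x /(_ Logic.I) fx.
by apply/integrableP; split=> //; rewrite -ge0_fin_numE// integral_ge0.
Qed.

(** Fubini for the composition of [mu] with [k]. The positive and negative parts are integrated
    separately; the points where the inner integral is a default value form a [mu]-null set by
    [kernel_comp_ae_integrable]. *)
Lemma kernel_comp_Rintegral u : nu.-integrable setT (EFin \o u) ->
  \int[nu]_x u x = \int[mu]_x kernel_op k u x.
Proof.
move=> iu; have [mu_ _] := integrableP _ _ _ iu.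
have iP := integrable_funepos measurableT iu.
have iN := integrable_funeneg measurableT iu.
rewrite /Rintegral integralE; congr fine.
have nP : nng_measurable (EFin \o u)^\+%E.
  by split; [exact: measurable_funepos|].
have nN : nng_measurable (EFin \o u)^\-%E.
  by split; [exact: measurable_funeneg|].
have jP : mu.-integrable setT (fun x => \int[k x]_y (EFin \o u)^\+ y)%E.
  have [mF F0] := kernel_integral_nng k nP.
  apply/integrableP; split=> //; under eq_integral do rewrite gee0_abs//.
  rewrite -(ge0_integral_kernel munu)//.
  by case/integrableP : iP => _; under eq_integral do rewrite gee0_abs//.
have jN : mu.-integrable setT (fun x => \int[k x]_y (EFin \o u)^\- y)%E.
  have [mF F0] := kernel_integral_nng k nN.
  apply/integrableP; split=> //; under eq_integral do rewrite gee0_abs//.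
  rewrite -(ge0_integral_kernel munu)//.
  by case/integrableP : iN => _; under eq_integral do rewrite gee0_abs//.
rewrite !(ge0_integral_kernel munu)// -integralB//.
apply: ae_eq_integral => //.
- by apply: emeasurable_funB; [case/integrableP : jP|case/integrableP : jN].
- by apply/measurable_EFinP/kernel_op_measurable/measurable_EFinP.
- apply: filterS (kernel_comp_ae_integrable iu) => x ix _.
  by rewrite -integralE /kernel_op /Rintegral fineK//; exact: integrable_fin_num.
Qed.

End composition.
End kernel_op.

(** * Kernels with an invariant measure as contractions of L_2 *)

Section invariant_kernel.
Context {d} {T : measurableType d} {R : realType}.
Variables (pi : {measure set T -> \bar R}) (pi1 : pi [set: T] = 1%E).
Variable k : R.-pker T ~> T.
Hypothesis pik : forall B, measurable B -> (\int[pi]_x k x B = pi B)%E.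
Implicit Types u v : T -> R.

(** Jensen's inequality for the probability [k x]. It holds at every [x], default values included:
    where [u] is not square integrable the right side is infinite. *)
Lemma kernel_op_sqr_le u x : measurable_fun setT u ->
  ((kernel_op k u x ^+ 2)%:E <= \int[k x]_y (u y ^+ 2)%:E)%E.
Proof.
move=> mu_; have mu2 : measurable_fun setT (fun y => (u y ^+ 2)%:E).
  by apply/measurable_EFinP; exact: measurable_funX.
have [->|fin] := eqVneq (\int[k x]_y (u y ^+ 2)%:E)%E +oo%E; first exact: leey.
have l2u : real_l2 (k x) u.
  split=> //; apply/integrableP; split=> //.
  under eq_integral do rewrite gee0_abs ?lee_fin ?sqr_ge0//.
  by rewrite ltey.
have := mean_sqr_le (prob_kernel x) l2u.
rewrite -lee_fin => /le_trans; apply.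
rewrite /ip /Rintegral.
under eq_integral do rewrite -expr2.
rewrite fineK//.
exact: (integrable_fin_num measurableT l2u.2).
Qed.

Lemma kernel_op_l2 u : real_l2 pi u -> real_l2 pi (kernel_op k u).
Proof.
move=> [mu_ iu]; have mK := kernel_op_measurable k mu_; split=> //.
have mK2 : measurable_fun setT (fun x => (kernel_op k u x ^+ 2)%:E).
  by apply/measurable_EFinP; exact: measurable_funX.
have n2 : nng_measurable (fun y => (u y ^+ 2)%:E).
  split; last by move=> y; rewrite lee_fin sqr_ge0.
  by apply/measurable_EFinP; exact: measurable_funX.
have [mF F0] := kernel_integral_nng k n2.
apply: (le_integrable measurableT (g := fun x => \int[k x]_y (u y ^+ 2)%:E)%E) => //.
  move=> x _; rewrite !gee0_abs ?lee_fin ?sqr_ge0//; exact: kernel_op_sqr_le.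
apply/integrableP; split=> //.
under eq_integral do rewrite gee0_abs//.
rewrite -(ge0_integral_kernel pik)//.
case/integrableP : iu => _.
by under eq_integral do rewrite gee0_abs ?lee_fin ?sqr_ge0//.
Qed.

Lemma kernel_op_contraction u : real_l2 pi u ->
  ip pi (kernel_op k u) (kernel_op k u) <= ip pi u u.
Proof.
move=> hu; have hK := kernel_op_l2 hu; have [mu_ iu] := hu.
have n2 : nng_measurable (fun y => (u y ^+ 2)%:E).
  split; last by move=> y; rewrite lee_fin sqr_ge0.
  by apply/measurable_EFinP; exact: measurable_funX.
have [mF F0] := kernel_integral_nng k n2.
rewrite /ip /Rintegral; under eq_integral do rewrite -expr2.
under [X in _ <= fine X]eq_integral do rewrite -expr2.
apply: fine_le.
- exact: (integrable_fin_num measurableT hK.2).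
- exact: (integrable_fin_num measurableT iu).
rewrite [leRHS](ge0_integral_kernel pik)//.
apply: ge0_le_integral => //.
- by move=> x _; rewrite lee_fin sqr_ge0.
- by case/integrableP : hK.2.
- by move=> x _; exact: kernel_op_sqr_le.
Qed.

Lemma kernel_opB u v : real_l2 pi u -> real_l2 pi v ->
  {ae pi, forall x,
    kernel_op k (fun y => u y - v y) x = kernel_op k u x - kernel_op k v x}.
Proof.
move=> hu hv.
apply: filterS2 (kernel_comp_ae_integrable pik (l2_integrable pi1 hu))
  (kernel_comp_ae_integrable pik (l2_integrable pi1 hv)) => x iu iv.
by rewrite /kernel_op RintegralB.
Qed.

(** By invariance a [pi]-null set is [k x]-null for [pi]-almost every [x]; hence [kernel_op] is well
    defined on classes of functions. *)
Lemma kernel_op_ae u v : measurable_fun setT u -> measurable_fun setT v ->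
  {ae pi, forall x, u x = v x} ->
  {ae pi, forall x, kernel_op k u x = kernel_op k v x}.
Proof.
move=> mu_ mv [N [mN N0 uvN]].
have : (\int[pi]_x `|k x N| = 0)%E.
  by under eq_integral do rewrite gee0_abs//; rewrite pik.
move=> /(ae_eq_integral_abs pi measurableT (measurable_kernel k N mN)).1.
apply: filterS => x /(_ Logic.I) kxN.
by apply: ae_eq_measurable_Rintegral => //; exists N.
Qed.

Lemma kernel_op_mean u : real_l2 pi u ->
  \int[pi]_x kernel_op k u x = \int[pi]_x u x.
Proof. by move=> hu; rewrite -(kernel_comp_Rintegral pik)//; exact: l2_integrable. Qed.

Lemma kernel_op_bounded M u : measurable_fun setT u -> (forall x, `|u x| <= M) ->
  forall x, `|kernel_op k u x| <= M.
Proof.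
move=> mu_ uM x; have k1 : k x [set: T] = 1%E by exact: prob_kernel.
have hu := bounded_l2 k1 mu_ uM; have iu := l2_integrable k1 hu.
apply: le_trans (le_normr_Rintegral measurableT iu) _.
have := le_Rintegral measurableT (f1 := fun y => `|u y|) (f2 := fun=> M)
  (integrable_norm iu) (l2_integrable k1 (l2_cst k1 M)).
by rewrite (Rintegral_probability_cst k1); apply=> y _; exact: uM.
Qed.

End invariant_kernel.

(** * Kernels in duality with respect to pi *)

Section duality.
Context {d} {T : measurableType d} {R : realType}.
Variables (pi : {measure set T -> \bar R}) (pi1 : pi [set: T] = 1%E).
Variables p q : R.-pker T ~> T.

(** The flip of the measure pi(dx) p(x, dy) on pairs is pi(dx) q(x, dy): [q] is the time reversal of
    [p]. For [p = q] this is detailed balance. *)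
Definition dual_kernels := forall A B : set T, measurable A -> measurable B ->
  (\int[pi]_(x in A) q x B = \int[pi]_(x in B) p x A)%E.

Hypothesis pq : dual_kernels.

Lemma dual_kernels_invariant_l B : measurable B -> (\int[pi]_x p x B = pi B)%E.
Proof.
move=> mB; rewrite -pq//.
under eq_integral do rewrite prob_kernel.
by rewrite integral_cst//= mul1e.
Qed.

Lemma dual_kernels_invariant_r B : measurable B -> (\int[pi]_x q x B = pi B)%E.
Proof.
move=> mB; rewrite pq//.
under eq_integral do rewrite prob_kernel.
by rewrite integral_cst//= mul1e.
Qed.

Local Open Scope ereal_scope.

Let integral_mul_indic (f : T -> \bar R) (A : set T) :
  \int[pi]_x (f x * (\1_A x)%:E) = \int[pi]_(x in A) f x.
Proof. by rewrite [RHS]integral_mkcond epatch_indic. Qed.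

(** The monotone class argument runs twice, one variable at a time: [half] frees [u] while [v] is an
    indicator, and then [v] is freed with [u] fixed. *)
Lemma dual_kernels_nng (u v : T -> \bar R) :
  nng_measurable u -> nng_measurable v ->
  \int[pi]_x (u x * \int[q x]_y v y) = \int[pi]_x (v x * \int[p x]_y u y).
Proof.
have half (f : T -> \bar R) B : nng_measurable f -> measurable B ->
    \int[pi]_x (q x B * f x) = \int[pi]_x ((\1_B x)%:E * \int[p x]_y f y).
  move=> nf mB.
  apply: (positive_functional_ext (positive_functional_integral pi (kernel_nng q mB))
    (positive_functional_kernel pi p (nng_measurable_indic mB)) _ nf) => A mA.
  rewrite integral_mul_indic pq// -integral_mul_indic.
  by apply: eq_integral => x _; rewrite integral_indic// setIT muleC.
move=> nu nv.
have -> : \int[pi]_x (v x * \int[p x]_y u y) = \int[pi]_x ((\int[p x]_y u y) * v x).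
  by apply: eq_integral => x _; rewrite muleC.
apply: (positive_functional_ext (positive_functional_kernel pi q nu)
  (positive_functional_integral pi (kernel_integral_nng p nu)) _ nv) => A mA.
transitivity (\int[pi]_x (q x A * u x)).
  by apply: eq_integral => x _; rewrite integral_indic// setIT muleC.
by rewrite half//; apply: eq_integral => x _; rewrite muleC.
Qed.

Lemma dual_kernels_ip (u v : T -> R) : real_l2 pi u -> real_l2 pi v ->
  ip pi u (kernel_op q v) = ip pi v (kernel_op p u).
Proof.
(* Adjointness is known for nonnegative functions, so both arguments are split into positive and
   negative parts and the four resulting identities are recombined by bilinearity. *)
have posneg (w : T -> R) : real_l2 pi w -> exists w1 w2 : T -> R,
    [/\ real_l2 pi w1, real_l2 pi w2, forall x, (0 <= w1 x)%R,
      forall x, (0 <= w2 x)%R & w = (fun x => w1 x - w2 x)%R].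
  move=> hw; have mw := hw.1.
  exists (fun x => Num.max (w x) 0)%R, (fun x => Num.max (- w x) 0)%R; split.
  - apply: l2_of_le hw _; first exact: measurable_maxr.
    move=> x; rewrite ger0_norm ?le_max ?lexx ?orbT// ge_max normr_ge0 andbT.
    exact: ler_norm.
  - apply: l2_of_le hw _; first by apply: measurable_maxr => //; exact: measurableT_comp.
    move=> x; rewrite ger0_norm ?le_max ?lexx ?orbT// ge_max normr_ge0 andbT.
    by rewrite -normrN ler_norm.
  - by move=> x; rewrite le_max lexx orbT.
  - by move=> x; rewrite le_max lexx orbT.
  - apply/funext => x; have /orP[w0|w0] := le_total 0%R (w x).
      by rewrite max_l// max_r ?subr0// oppr_le0.
    by rewrite max_r// max_l ?sub0r ?opprK// oppr_ge0.
have nng (w : T -> R) : real_l2 pi w -> (forall x, (0 <= w x)%R) ->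
    nng_measurable (EFin \o w).
  by move=> [mw _] w0; split; [exact/measurable_EFinP|move=> x; rewrite lee_fin].
have ivp := dual_kernels_invariant_l; have ivq := dual_kernels_invariant_r.
have ae_fin (k : R.-pker T ~> T) (w : T -> R) :
    (forall B, measurable B -> \int[pi]_x k x B = pi B) -> real_l2 pi w ->
    {ae pi, forall x, \int[k x]_y (w y)%:E = (kernel_op k w x)%:E}.
  move=> ivk hw.
  apply: filterS (kernel_comp_ae_integrable ivk (l2_integrable pi1 hw)) => x iw.
  by rewrite /kernel_op /Rintegral fineK//; exact: integrable_fin_num.
have ipE (k : R.-pker T ~> T) (u1 v1 : T -> R) :
    (forall B, measurable B -> \int[pi]_x k x B = pi B) ->
    real_l2 pi u1 -> real_l2 pi v1 ->
    (forall x, (0 <= u1 x)%R) -> (forall x, (0 <= v1 x)%R) ->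
    ip pi u1 (kernel_op k v1) =
      fine (\int[pi]_x ((u1 x)%:E * \int[k x]_y (v1 y)%:E)).
  move=> ivk hu hv u0 v0; rewrite /ip /Rintegral; congr fine.
  have [mk k0] := kernel_integral_nng k (nng _ hv v0).
  apply: ae_eq_integral => //.
  - apply/measurable_EFinP; apply: measurable_funM; first exact: hu.1.
    exact: kernel_op_measurable hv.1.
  - by apply: emeasurable_funM => //; apply/measurable_EFinP; exact: hu.1.
  - by apply: filterS (ae_fin k v1 ivk hv) => x /= -> _; rewrite EFinM.
have dual_nng (u1 v1 : T -> R) : real_l2 pi u1 -> real_l2 pi v1 ->
    (forall x, (0 <= u1 x)%R) -> (forall x, (0 <= v1 x)%R) ->
    ip pi u1 (kernel_op q v1) = ip pi v1 (kernel_op p u1).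
  move=> hu hv u0 v0; rewrite !ipE//; congr fine.
  exact: (dual_kernels_nng (nng _ hu u0) (nng _ hv v0)).
have splitr (k : R.-pker T ~> T) (w v1 v2 : T -> R) :
    (forall B, measurable B -> \int[pi]_x k x B = pi B) ->
    real_l2 pi w -> real_l2 pi v1 -> real_l2 pi v2 ->
    ip pi w (kernel_op k (fun x => v1 x - v2 x)%R) =
      (ip pi w (kernel_op k v1) - ip pi w (kernel_op k v2))%R.
  move=> ivk hw h1 h2; have k1 := kernel_op_l2 ivk h1; have k2 := kernel_op_l2 ivk h2.
  rewrite -ipBr// !(ipC pi w); apply: ip_ae.
  - by apply: kernel_op_measurable; exact: (l2B h1 h2).1.
  - exact: (l2B k1 k2).1.
  - exact: hw.1.
  - exact: kernel_opB.
move=> hu hv.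
have [u1 [u2 [hu1 hu2 u10 u20 uE]]] := posneg u hu.
have [v1 [v2 [hv1 hv2 v10 v20 vE]]] := posneg v hv.
rewrite [in LHS]vE splitr// [in RHS]uE splitr//.
have Kq w : real_l2 pi w -> real_l2 pi (kernel_op q w) by exact: kernel_op_l2.
have Kp w : real_l2 pi w -> real_l2 pi (kernel_op p w) by exact: kernel_op_l2.
rewrite [in LHS]uE [in RHS]vE.
rewrite !(ipBl hu1 hu2, ipBl hv1 hv2); try exact: Kq; try exact: Kp.
by rewrite !dual_nng//; ring.
Qed.

End duality.

(** * Scalar decay estimates *)

Section decay.
Context {R : realType}.
Implicit Types h : R -> R.

Lemma bernoulli_ineq (r : R) (n : nat) : 1 <= r -> 1 + n%:R * (r - 1) <= r ^+ n.
Proof.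
move=> r1; elim: n => [|n ih]; first by rewrite expr0 mul0r addr0.
have n0 : 0 <= n%:R :> R by rewrite ler0n.
rewrite exprS -natr1; apply: le_trans (ler_wpM2l _ ih); last by lra.
rewrite -subr_ge0; have := mulr_ge0 n0 (sqr_ge0 (r - 1)).
by congr (_ <= _); ring.
Qed.

(** Put r(t) = h(t) e^{beta t} / h(0). The doubling inequality says r(t)^2 <= r(2t), while r <= K /
    h(0) throughout; r(t) > 1 would make r(t)^(2^n) unbounded. *)
Lemma log_convex_decay h (K beta : R) : (forall t, 0 <= t -> 0 <= h t) ->
  (forall t, 0 <= t -> h t ^+ 2 <= h (2 * t) * h 0) ->
  (forall t, 0 <= t -> h t <= K * expR (- (beta * t))) ->
  forall t, 0 <= t -> h t <= expR (- (beta * t)) * h 0.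
Proof.
move=> h0 hsq hK t t0; rewrite leNgt; apply/negP => ht.
have := h0 0 (lexx _); rewrite le_eqVlt => /orP[/eqP h00|h00].
  have := hsq t t0; rewrite -h00 mulr0 => hh.
  by move: ht; rewrite -h00 mulr0 => /(exprn_gt0 2); lra.
pose r := h t * expR (beta * t) / h 0.
have r1 : 1 < r.
  rewrite /r ltr_pdivlMr// mul1r mulrC -ltr_pdivrMl ?expR_gt0//.
  by rewrite -expRN.
have step (n : nat) : r ^+ (2 ^ n) <=
    h ((2 ^ n)%:R * t) * expR (beta * ((2 ^ n)%:R * t)) / h 0.
  elim: n => [|n ih]; first by rewrite expn0 mul1r.
  set s := (2 ^ n)%:R * t in ih *.
  have s0 : 0 <= s by rewrite mulr_ge0.
  have -> : (2 ^ n.+1)%:R * t = 2 * s by rewrite expnS natrM mulrA.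
  rewrite expnS mulnC exprM.
  apply: (@le_trans _ _ ((h s * expR (beta * s) / h 0) ^+ 2)).
    by rewrite lerXn2r// nnegrE; [rewrite exprn_ge0// ltW// (lt_trans _ r1)|
      rewrite !mulr_ge0 ?h0 ?expR_ge0 ?invr_ge0 ?h0].
  have -> : beta * (2 * s) = beta * s + beta * s by ring.
  rewrite expRD.
  have -> : (h s * expR (beta * s) / h 0) ^+ 2 =
     h s ^+ 2 * (expR (beta * s) ^+ 2 * (h 0)^-1 ^+ 2) by ring.
  have -> : h (2 * s) * (expR (beta * s) * expR (beta * s)) / h 0 =
     (h (2 * s) * h 0) * (expR (beta * s) ^+ 2 * (h 0)^-1 ^+ 2).
    by field; rewrite lt0r_neq0.
  by rewrite ler_wpM2r ?hsq// mulr_ge0 ?sqr_ge0.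
(* Linear growth in [n] already contradicts a fixed bound, so 2^n is weakened to [n] inside
   Bernoulli's inequality. *)
have bound (n : nat) : 1 + n%:R * (r - 1) <= K / h 0.
  apply: (@le_trans _ _ (1 + (2 ^ n)%:R * (r - 1))).
    by rewrite lerD2l ler_wpM2r ?subr_ge0 ?(ltW r1)// ler_nat ltnW// ltn_expl.
  apply: le_trans (bernoulli_ineq _ (ltW r1)) _.
  apply: le_trans (step n) _.
  rewrite ler_wpM2r ?invr_ge0 ?h0//.
  have s0 : 0 <= (2 ^ n)%:R * t by rewrite mulr_ge0.
  by rewrite -ler_pdivlMr ?expR_gt0// -expRN hK.
have rr : 0 < r - 1 by rewrite subr_gt0.
have := bound (Num.truncn (`|K / h 0| / (r - 1))).+1.
have := truncnS_gt (`|K / h 0| / (r - 1)).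
by rewrite ltr_pdivrMr// => h1 h2; have := ler_norm (K / h 0); lra.
Qed.

(* Monotonicity of [h] takes the place of left continuity: it bounds
   [expR (beta * t) * h t] at a supremum of times by its values before. *)
Lemma right_differential_decay h (beta : R) : 0 <= beta ->
  (forall t, 0 <= t -> 0 <= h t) ->
  (forall t s, 0 <= t -> 0 <= s -> h (t + s) <= h t) ->
  (forall t eps, 0 <= t -> 0 < eps -> exists2 delta, 0 < delta &
     forall s, 0 < s < delta -> h (t + s) <= h t * (1 - beta * s) + eps * s) ->
  forall t, 0 <= t -> h t <= expR (- (beta * t)) * h 0.
Proof.
move=> b0 h0 hmono hdiff t t0.
(* The claim becomes [k t <= k 0], where [kdiff] says that the upper right slope of [k] is at most
   0. *)
pose k s := expR (beta * s) * h s.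
have k0 s : 0 <= s -> 0 <= k s by move=> s0; rewrite mulr_ge0 ?expR_ge0 ?h0.
have kdiff s eps : 0 <= s -> 0 < eps -> exists2 delta, 0 < delta &
    forall r, 0 < r < delta -> k (s + r) <= k s + eps * r.
  move=> s0 e0.
  (* With r < 1 the weight e^{beta (s + r)} is at most e^{beta (s + 1)}, so this error, once
     multiplied by the weight, stays below [eps]. *)
  have e1 : 0 < eps * expR (- (beta * (s + 1))) by rewrite mulr_gt0 ?expR_gt0.
  have [delta d0 hd] := hdiff s _ s0 e1.
  exists (Num.min delta 1); first by rewrite lt_min d0 ltr01.
  move=> r /andP[r0]; rewrite lt_min => /andP[rd r1].
  have {}hd := hd r; rewrite r0 rd in hd; have {}hd := hd isT.
  rewrite /k mulrDr expRD.
  have ebr : expR (beta * r) * (1 - beta * r) <= 1.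
    rewrite mulrC -ler_pdivlMr ?expR_gt0// mul1r -expRN.
    by have := expR_ge1Dx (- (beta * r)).
  have ebs : expR (beta * s) * expR (beta * r) * expR (- (beta * (s + 1))) <= 1.
    by rewrite -!expRD -[leRHS]expR0 ler_expR; have := ler_wpM2l b0 (ltW r1); lra.
  have hs := h0 s s0; have p1 := expR_gt0 (beta * s); have p2 := expR_gt0 (beta * r).
  apply: le_trans (ler_wpM2l _ hd) _; first by rewrite mulr_ge0 ?expR_ge0.
  have -> : expR (beta * s) * expR (beta * r) * (h s * (1 - beta * r) +
      eps * expR (- (beta * (s + 1))) * r) =
    (expR (beta * s) * h s) * (expR (beta * r) * (1 - beta * r)) +
    (eps * r) * (expR (beta * s) * expR (beta * r) * expR (- (beta * (s + 1)))) by ring.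
  apply: lerD; rewrite -[leRHS]mulr1; apply: ler_wpM2l => //.
    by rewrite mulr_ge0// ltW.
  by rewrite mulr_ge0// ltW.
suff main eps : 0 < eps -> k t <= k 0 + eps.
  have : k t <= k 0 by apply/ler_addgt0Pr => e e0; exact: main.
  rewrite /k mulr0 expR0 mul1r => kt.
  by rewrite expRN -ler_pdivrMl ?invr_gt0 ?expR_gt0// invrK.
move=> eps0.
have [->|tn0] := eqVneq t 0; first by rewrite lerDl ltW.
have tgt0 : 0 < t by rewrite lt_def tn0.
pose e := eps / t; have e0 : 0 < e by rewrite divr_gt0.
have -> : eps = e * t by rewrite /e divfK.
rewrite leNgt; apply/negP => ktbig.
(* Continuous induction: [E] holds the times up to which the line of slope [e] stays above [k]. Its
   supremum [c] is at most [t], satisfies the bound itself by [kc], and can then be passed by means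
   of [kdiff], which is absurd. *)
pose E := [set s | 0 <= s /\ forall r, 0 <= r <= s -> k r <= k 0 + e * r].
have E0 : E 0.
  split=> // r /andP[r0 r1]; have -> : r = 0 by apply/eqP; rewrite eq_le r0 r1.
  by rewrite mulr0 addr0.
have Et s : E s -> s <= t.
  move=> [s0 Es]; rewrite leNgt; apply/negP => ts.
  by move: ktbig; rewrite ltNge Es// t0 ltW.
have supE : has_sup E by split; [exists 0|exists t => s /Et].
pose c := sup E.
have c0 : 0 <= c by apply: ub_le_sup E0; case: supE.
have kc : k c <= k 0 + e * c.
  rewrite leNgt; apply/negP => kcb.
  have kc0 : 0 < k c.
    by apply: le_lt_trans kcb; rewrite addr_ge0 ?k0// mulr_ge0// ltW.
  (* Going back from [c] by less than [eta] costs at most [beta * eta * k c], and [eta] makes this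
     less than half of the excess of [k c] over the line. The 1 in [beta + 1] covers [beta = 0]. *)
  pose eta := (k c - (k 0 + e * c)) / (2 * (beta + 1) * k c).
  have b1 : 0 < beta + 1 by lra.
  have eta0 : 0 < eta.
    by apply: divr_gt0; [rewrite subr_gt0|apply: mulr_gt0 => //; apply: mulr_gt0].
  have [s Es cs] := sup_adherent eta0 supE.
  have [s0 Es'] := Es.
  have sc : s <= c by apply: ub_le_sup Es; case: supE.
  have ks : k s <= k 0 + e * s by apply: Es'; rewrite s0 lexx.
  have esc : e * s <= e * c by rewrite ler_wpM2l// ltW.
  have kcs : k c * (1 - beta * (c - s)) <= k s.
    have -> : k c = expR (beta * s) * expR (beta * (c - s)) * h c.
      by rewrite -expRD -mulrDr addrC subrK -/(k c).
    have hcs : h c <= h s.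
      have -> : c = s + (c - s) by ring.
      by apply: hmono => //; lra.
    have e1 : expR (beta * (c - s)) * (1 - beta * (c - s)) <= 1.
      rewrite mulrC -ler_pdivlMr ?expR_gt0// mul1r -expRN.
      by have := expR_ge1Dx (- (beta * (c - s))).
    have -> : expR (beta * s) * expR (beta * (c - s)) * h c * (1 - beta * (c - s)) =
      expR (beta * s) * h c * (expR (beta * (c - s)) * (1 - beta * (c - s))) by ring.
    apply: (@le_trans _ _ (expR (beta * s) * h c)).
      by rewrite -[leRHS]mulr1 ler_wpM2l// mulr_ge0 ?expR_ge0 ?h0.
    by rewrite /k ler_wpM2l ?expR_ge0.
  have : k c - (k 0 + e * c) <= beta * eta * k c.
    have bs : beta * (c - s) <= beta * eta.
      by rewrite ler_wpM2l//; move: cs; rewrite -/c; lra.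
    by have := ler_wpM2r (ltW kc0) bs; lra.
  have -> : beta * eta * k c = (k c - (k 0 + e * c)) * (beta / (2 * (beta + 1))).
    by rewrite /eta; field; rewrite lt0r_neq0//= ; lra.
  have : beta / (2 * (beta + 1)) < 1 by rewrite ltr_pdivrMr; lra.
  move: kcb; set x := k c - _ => kcb; have : 0 < x by rewrite subr_gt0.
  nra.
have [delta d0 kd] := kdiff c e c0 e0.
have : E (c + delta / 2).
  split; first by lra.
  move=> r /andP[r0 rc].
  have [rltc|] := ltP r c.
    have cr0 : 0 < c - r by lra.
    have [s Es cs] := sup_adherent cr0 supE.
    by apply Es.2; rewrite r0/= ltW//; move: cs; rewrite -/c; lra.
  rewrite le_eqVlt => /orP[/eqP <-//|cr].
  have := kd (r - c); rewrite [c + _]addrC subrK => {}kd.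
  have : k r <= k c + e * (r - c) by apply: kd; lra.
  by move: kc; lra.
move=> /ub_le_sup cc; have : c + delta / 2 <= c by apply: cc; case: supE.
by lra.
Qed.

End decay.

(** * Generators and mean decay *)

Section l2norm.
Context {d} {T : measurableType d} {R : realType}.
Variables (pi : {measure set T -> \bar R}) (pi1 : pi [set: T] = 1%E).
Implicit Types (u v w g : T -> R) (k : R.-pker T ~> T).

Definition l2norm u : R := Num.sqrt (ip pi u u).

Lemma l2norm_ge0 u : 0 <= l2norm u. Proof. exact: sqrtr_ge0. Qed.

Lemma l2norm_sqr u : l2norm u ^+ 2 = ip pi u u.
Proof. by rewrite sqr_sqrtr ?ip_ge0. Qed.

Lemma l2normZ a u : real_l2 pi u -> l2norm (fun x => a * u x) = `|a| * l2norm u.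
Proof. by move=> hu; rewrite /l2norm nsqZ// sqrtrM ?sqr_ge0// sqrtr_sqr. Qed.

Lemma l2norm_le_expR u v (b : R) : (l2norm u <= expR (- (b / 2)) * l2norm v) =
  (ip pi u u <= expR (- b) * ip pi v v).
Proof.
rewrite -!l2norm_sqr -ler_sqr ?nnegrE ?mulr_ge0 ?expR_ge0 ?l2norm_ge0//.
by rewrite exprMn -expRM_natl (_ : 2 * - (b / 2) = - b)//; field.
Qed.

Section invariant.
Variable k : R.-pker T ~> T.
Hypothesis pik : forall B, measurable B -> (\int[pi]_x k x B = pi B)%E.

Lemma kernel_op_decay_dense (c : R) u : 0 <= c -> real_l2 pi u ->
  (forall e, 0 < e -> exists g, [/\ real_l2 pi g,
     l2norm (fun x => u x - g x) <= e &
     l2norm (kernel_op k g) <= c * l2norm g]) ->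
  l2norm (kernel_op k u) <= c * l2norm u.
Proof.
move=> c0 hu dense; apply/ler_addgt0Pr => eta eta0.
have c1 : 0 < c + 1 by lra.
(* Replacing [u] by [g] costs this error once through contractivity of the operator and [c] times
   through the norm on the right: [c + 1] times in all. *)
have [g [hg ug Kg]] := dense (eta / (c + 1)) (divr_gt0 eta0 c1).
have hKu := kernel_op_l2 pik hu; have hKg := kernel_op_l2 pik hg.
have hug := l2B hu hg; have hKug := l2B hKu hKg.
have h1 : l2norm (kernel_op k u) <=
    l2norm (kernel_op k g) + l2norm (fun x => kernel_op k u x - kernel_op k g x).
  have := minkowskiD hKg hKug; congr (l2norm _ <= _).
  by apply/funext => x; rewrite addrC subrK.
have h2 : l2norm (fun x => kernel_op k u x - kernel_op k g x) <= eta / (c + 1).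
  apply: le_trans ug; rewrite /l2norm -(nsq_ae _ hKug.1 (kernel_opB pi1 pik hu hg)).
    by rewrite ler_sqrt ?ip_ge0//; exact: kernel_op_contraction.
  exact: kernel_op_measurable hug.1.
have h3 : l2norm g <= l2norm u + eta / (c + 1).
  apply: le_trans (lerD (lexx _) ug).
  have := minkowskiB hu hug; congr (l2norm _ <= _).
  by apply/funext => x; rewrite opprB addrC subrK.
have -> : eta = c * (eta / (c + 1)) + eta / (c + 1) by field; rewrite lt0r_neq0.
have := ler_wpM2l c0 h3; lra.
Qed.

End invariant.

(** Truncation at height [n] converges by dominated convergence but spoils the mean. Recentring is
    free: as [u] has mean zero, the new error is the old one minus its own mean, and [variance_le]
    applies. *)
Lemma bounded_dense u : real_l2 pi u -> \int[pi]_x u x = 0 ->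
  forall e, 0 < e -> exists g, exists M, [/\ measurable_fun setT g,
    forall x, `|g x| <= M, \int[pi]_x g x = 0 & l2norm (fun x => u x - g x) <= e].
Proof.
move=> hu u0 e e0.
pose un (n : nat) x := Num.max (Num.min (u x) n%:R) (- n%:R).
have mun n : measurable_fun setT (un n).
  apply: measurable_maxr => //; apply: measurable_minr => //; exact: hu.1.
have unM n x : `|un n x| <= n%:R.
  by rewrite ler_norml /un le_max lexx orbT ge_max ge_min lexx orbT/= ge0_cp// ler0n.
have uun n x : `|u x - un n x| <= `|u x|.
  have n0 : 0 <= n%:R :> R by [].
  rewrite /un; have [h1|h1] := leP (u x) n%:R.
    have [h2|h2] := leP (- n%:R) (u x); first by rewrite subrr normr0.
    by rewrite !ltr0_norm; lra.
  have [h2|h2] := leP (- n%:R) (n%:R : R); last by lra.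
  by rewrite !ger0_norm; lra.
have hun n : real_l2 pi (un n) by exact: bounded_l2 (mun n) (unM n).
have hD n : real_l2 pi (fun x => u x - un n x) by exact: l2B.
have cvg0 : (\int[pi]_x ((u x - un n x) ^+ 2)%:E)%E @[n --> \oo] --> 0%E.
  have := @dominated_convergence _ _ _ pi setT measurableT
    (fun n x => ((u x - un n x) ^+ 2)%:E) (cst 0%E) (fun x => (u x ^+ 2)%:E).
  case.
  - by move=> n; case/integrableP : (hD n).2.
  - exact: measurable_cst.
  - apply: aeW => x _; apply: cvg_near_cst.
    near=> n; have ux : `|u x| <= n%:R.
      by near: n; exact: nbhs_infty_ger.
    move: ux; rewrite ler_norml => /andP[h1 h2].
    by rewrite /un min_l// max_l// subrr expr0n.
  - exact: hu.2.
  - apply: aeW => x n _; rewrite gee0_abs ?lee_fin ?sqr_ge0//.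
    by rewrite -(real_normK (num_real (u x - _))) -(real_normK (num_real (u x)))
      ler_sqr ?nnegrE.
  - by move=> _ _; rewrite integral0.
have e2 : 0 < e ^+ 2 by rewrite exprn_gt0.
have [n hn] : exists n, ip pi (fun x => u x - un n x) (fun x => u x - un n x) <= e ^+ 2.
  have [n _ /(_ n (leqnn n)) /= /ltW hn] := cvgr_lt _ (fine_cvg cvg0) _ e2.
  by exists n; rewrite /ip /Rintegral; under eq_integral do rewrite -expr2.
have iu := l2_integrable pi1 hu; have iun := l2_integrable pi1 (hun n).
have mD : \int[pi]_x (u x - un n x) = - \int[pi]_x un n x.
  by rewrite RintegralB// u0 sub0r.
exists (fun x => un n x - \int[pi]_y un n y), (n%:R + `|\int[pi]_y un n y|); split.
- exact: measurable_funB.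
- by move=> x; apply: le_trans (ler_normB _ _) _; rewrite lerD2r.
- rewrite RintegralB//; last exact: (l2_integrable pi1 (l2_cst pi1 _)).
  by rewrite (Rintegral_probability_cst pi1) subrr.
- rewrite /l2norm -(ger0_norm (ltW e0)) -sqrtr_sqr ler_sqrt ?(ltW e2)//.
  apply: le_trans hn; apply: le_trans (variance_le pi1 (hD n)).
  rewrite mD le_eqVlt; apply/orP; left; apply/eqP.
  by congr (ip pi _ _); apply/funext => x; ring.
Unshelve. all: by end_near. Qed.

End l2norm.

(** * First-order expansions at time 0 and the transfer of decay *)

Section semigroup_generator.
Context {d} {T : measurableType d} {R : realType}.
Variables (pi : {measure set T -> \bar R}) (pi1 : pi [set: T] = 1%E).
Implicit Types (p q : R -> R.-pker T ~> T) (u v w g a : T -> R).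

Definition invariant_family p := forall (t : R) (B : set T),
  0 <= t -> measurable B -> (\int[pi]_x p t x B = pi B)%E.

Definition generator_at p u a := [/\ real_l2 pi u, real_l2 pi a &
  forall e, 0 < e -> exists2 delta, 0 < delta & forall s, 0 < s < delta ->
    l2norm pi (fun x => s^-1 * (kernel_op (p s) u x - u x) - a x) <= e].

Section one_generator.
Variables (p : R -> R.-pker T ~> T) (u a : T -> R).
Hypotheses (pip : invariant_family p) (gen : generator_at p u a).

Let hu : real_l2 pi u. Proof. by case: gen. Qed.
Let ha : real_l2 pi a. Proof. by case: gen. Qed.

Let hK s : 0 <= s -> real_l2 pi (kernel_op (p s) u).
Proof. by move=> s0; apply: kernel_op_l2 hu => B; exact: pip. Qed.

Lemma generator_ip w : real_l2 pi w -> forall e, 0 < e ->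
  exists2 delta, 0 < delta & forall s, 0 < s < delta ->
    `|ip pi (kernel_op (p s) u) w - ip pi u w - s * ip pi a w| <= s * e.
Proof.
move=> hw e e0; have N0 := l2norm_ge0 pi w.
have N1 : 0 < l2norm pi w + 1 by lra.
have [_ _ /(_ _ (divr_gt0 e0 N1))[delta d0 hd]] := gen.
exists delta => // s sd; have /andP[s0 _] := sd.
have hs := hK (ltW s0); have hB := l2B hs hu; have hZ := l2Z s^-1 hB.
have := cauchy_schwarz (l2B hZ ha) hw; rewrite -!/(l2norm _ _).
rewrite ipBl// ipZl// ipBl// => cs.
have -> : ip pi (kernel_op (p s) u) w - ip pi u w - s * ip pi a w =
    s * (s^-1 * (ip pi (kernel_op (p s) u) w - ip pi u w) - ip pi a w).
  by field; rewrite lt0r_neq0.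
rewrite normrM gtr0_norm// ler_wpM2l ?(ltW s0)//; apply: le_trans cs _.
apply: le_trans (ler_wpM2r N0 (hd s sd)) _.
rewrite -mulrA ler_piMr ?(ltW e0)// mulrC ler_pdivrMr//; lra.
Qed.

(* Writing [p s u = u + s (a + r)] with [r] small, [||p s u||^2] differs from its
   first-order expansion by [||p s u - u||^2 = O(s^2)]. *)
Lemma generator_nsq_le e : 0 < e -> exists2 delta, 0 < delta &
  forall s, 0 < s < delta ->
    ip pi (kernel_op (p s) u) (kernel_op (p s) u) <=
    ip pi u u + 2 * s * ip pi a u + s * e.
Proof.
move=> e0; have e4 : 0 < e / 4 by lra.
have [d1 d10 h1] := generator_ip hu e4.
have [_ _ /(_ _ ltr01)[d2 d20 h2]] := gen.
have N0 := l2norm_ge0 pi a; set N := l2norm pi a in N0 *.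
have N1 : 0 < (N + 1) ^+ 2 by rewrite exprn_gt0//; lra.
(* The last bound turns the quadratic remainder (s (N + 1))^2 into at most s e / 2; the other s e /
   2 is twice the error [e / 4] of the inner product. *)
exists (Num.min (Num.min d1 d2) (e / 2 / (N + 1) ^+ 2)).
  by rewrite !lt_min d10 d20 !divr_gt0.
move=> s /andP[s0]; rewrite !lt_min => /andP[/andP[sd1 sd2] sd3].
have hs := hK (ltW s0); have hB := l2B hs hu; have hZ := l2Z s^-1 hB.
have {}h1 : ip pi (kernel_op (p s) u) u - ip pi u u - s * ip pi a u <= s * (e / 4).
  by apply: le_trans (ler_norm _) (h1 s _); rewrite s0.
have {}h2 : l2norm pi (fun x => s^-1 * (kernel_op (p s) u x - u x) - a x) <= 1.
  by apply: h2; rewrite s0.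
have nB : l2norm pi (fun x => kernel_op (p s) u x - u x) <= s * (N + 1).
  have := minkowskiD (l2B hZ ha) ha; rewrite -!/(l2norm _ _).
  have -> : (fun x => s^-1 * (kernel_op (p s) u x - u x) - a x + a x) =
    (fun x => s^-1 * (kernel_op (p s) u x - u x)).
    by apply/funext => x; rewrite subrK.
  rewrite l2normZ// gtr0_norm ?invr_gt0// => h3.
  by rewrite -ler_pdivrMl//; apply: le_trans h3 _; rewrite addrC lerD2l.
have nsqB : ip pi (fun x => kernel_op (p s) u x - u x)
    (fun x => kernel_op (p s) u x - u x) <= s * (e / 2).
  rewrite -l2norm_sqr; apply: (@le_trans _ _ ((s * (N + 1)) ^+ 2)).
    by rewrite ler_sqr ?nnegrE ?l2norm_ge0// mulr_ge0 ?(ltW s0)//; lra.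
  rewrite exprMn expr2 -mulrA ler_wpM2l ?(ltW s0)//.
  by rewrite -ler_pdivlMr// ltW.
have -> : ip pi (kernel_op (p s) u) (kernel_op (p s) u) =
    ip pi u u + 2 * (ip pi (kernel_op (p s) u) u - ip pi u u) +
    ip pi (fun x => kernel_op (p s) u x - u x) (fun x => kernel_op (p s) u x - u x).
  by rewrite ipBl// !ipBr// (ipC pi u); ring.
by lra.
Qed.

(** From 2 (P_s u, u) <= ||P_s u||^2 + ||u||^2 and the assumed decay, 2 (P_s u - u, u) <= (e^{- beta
    s} - 1) ||u||^2. Dividing by [s] and letting it tend to 0 gives the claim; the proof does this
    with one small [s] for each [e]. *)
Lemma generator_dissipative (beta : R) : 0 <= beta ->
  (forall s, 0 <= s -> ip pi (kernel_op (p s) u) (kernel_op (p s) u) <=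
     expR (- (beta * s)) * ip pi u u) ->
  2 * ip pi a u <= - beta * ip pi u u.
Proof.
move=> b0 decay; apply/ler_addgt0Pr => e e0.
have e4 : 0 < e / 4 by lra.
have [d1 d10 h1] := generator_ip hu e4.
have nu0 := ip_ge0 pi u; set nu := ip pi u u in decay nu0 h1 *.
have q0 : 0 < beta ^+ 2 * nu + 1 by rewrite ltr_wpDl// mulr_ge0 ?sqr_ge0.
(* The second bound absorbs the quadratic term of e^{-y} <= 1 - y + y^2 at y = beta s; the added 1
   keeps the denominator positive. *)
pose s := Num.min (d1 / 2) (e / 2 / (beta ^+ 2 * nu + 1)).
have s0 : 0 < s by rewrite lt_min !divr_gt0.
have sd1 : s < d1.
  by apply: (@le_lt_trans _ _ (d1 / 2)); [rewrite ge_min lexx|lra].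
have sq : s * (beta ^+ 2 * nu + 1) <= e / 2.
  by rewrite -ler_pdivlMr// /s ge_min lexx orbT.
have {}h1 := h1 s; rewrite s0 sd1 in h1; have {}h1 := h1 isT.
move: h1; rewrite ler_norml => /andP[h1 _].
have hs := hK (ltW s0).
have amgm : 2 * ip pi (kernel_op (p s) u) u <=
    ip pi (kernel_op (p s) u) (kernel_op (p s) u) + nu.
  have := ip_ge0 pi (fun x => kernel_op (p s) u x - u x).
  by rewrite ipBl ?ipBr//; [rewrite (ipC pi u (kernel_op _ _)) -/nu; lra|exact: l2B].
have dec := decay s (ltW s0).
pose y := beta * s; have y0 : 0 <= y by apply: mulr_ge0 => //; exact: ltW.
have expy : expR (- y) <= 1 - y + y ^+ 2.
  have y1 : 0 < 1 + y by lra.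
  apply: (@le_trans _ _ (1 + y)^-1).
    by rewrite expRN lef_pV2 ?posrE ?expR_gt0// expR_ge1Dx.
  rewrite -[leLHS]mul1r ler_pdivrMr//.
  have -> : (1 - y + y ^+ 2) * (1 + y) = 1 + y ^+ 3 by ring.
  by rewrite lerDl exprn_ge0.
have : 2 * (s * ip pi a u) <= (- y + y ^+ 2) * nu + s * (e / 2).
  have := ler_wpM2r nu0 expy; rewrite -/y in dec; lra.
have -> : (- y + y ^+ 2) * nu + s * (e / 2) =
  s * (- beta * nu + s * (beta ^+ 2 * nu) + e / 2) by rewrite /y; ring.
rewrite mulrCA ler_pM2l// => h2; apply: le_trans h2 _.
rewrite -addrA lerD2l.
have : s * (beta ^+ 2 * nu) <= s * (beta ^+ 2 * nu + 1) by rewrite ler_pM2l//; lra.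
by lra.
Qed.

End one_generator.

(** Duality makes (p_s u, u) and (q_s u, u) the same function of [s], and the two sides are its
    right derivative at 0. *)
Lemma generator_dual_ip p q u a a' : invariant_family p -> invariant_family q ->
  (forall t, 0 <= t -> dual_kernels pi (p t) (q t)) ->
  generator_at p u a -> generator_at q u a' -> ip pi a u = ip pi a' u.
Proof.
move=> pip piq pq ga ga'; have hu : real_l2 pi u by case: ga.
apply/eqP; rewrite -subr_eq0 -normr_eq0 eq_le normr_ge0 andbT.
apply/ler_addgt0Pr => e e0; rewrite add0r.
have e2 : 0 < e / 2 by lra.
have [d1 d10 h1] := generator_ip pip ga hu e2.
have [d2 d20 h2] := generator_ip piq ga' hu e2.
pose s := Num.min (d1 / 2) (d2 / 2).
have s0 : 0 < s by rewrite lt_min !divr_gt0.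
have sd1 : s < d1.
  by apply: (@le_lt_trans _ _ (d1 / 2)); [rewrite ge_min lexx|lra].
have sd2 : s < d2.
  by apply: (@le_lt_trans _ _ (d2 / 2)); [rewrite ge_min lexx orbT|lra].
have {}h1 := h1 s; rewrite s0 sd1 in h1; have {}h1 := h1 isT.
have {}h2 := h2 s; rewrite s0 sd2 in h2; have {}h2 := h2 isT.
have eqpq : ip pi (kernel_op (p s) u) u = ip pi (kernel_op (q s) u) u.
  by rewrite ipC (ipC _ (kernel_op (q s) u)) (dual_kernels_ip pi1 (pq s (ltW s0))).
rewrite -(ler_pM2l s0) -[X in X * `|_|](gtr0_norm s0) -normrM.
have -> : s * (ip pi a u - ip pi a' u) =
  (ip pi (kernel_op (q s) u) u - ip pi u u - s * ip pi a' u) -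
  (ip pi (kernel_op (p s) u) u - ip pi u u - s * ip pi a u).
  by rewrite eqpq; ring.
by apply: le_trans (ler_normB _ _) _; lra.
Qed.

(** The identity is asked almost everywhere because [kernel_op] takes default values where [u] is
    not integrable. *)
Definition semigroup_family p := forall s t u, 0 <= s -> 0 <= t ->
  real_l2 pi u -> {ae pi, forall x,
    kernel_op (p (s + t)) u x = kernel_op (p s) (kernel_op (p t) u) x}.

Definition mean_decay p (beta : R) := forall t u, 0 <= t -> real_l2 pi u ->
  \int[pi]_x u x = 0 -> ip pi (kernel_op (p t) u) (kernel_op (p t) u) <=
    expR (- (beta * t)) * ip pi u u.

Lemma reversible_mean_decay p (beta : R) : invariant_family p ->
  semigroup_family p ->
  (forall t, 0 <= t -> dual_kernels pi (p t) (p t)) ->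
  (forall u x, measurable_fun setT u -> kernel_op (p 0) u x = u x) ->
  (forall g M, measurable_fun setT g -> (forall x, `|g x| <= M) ->
     \int[pi]_x g x = 0 -> exists K, forall t, 0 <= t ->
       ip pi (kernel_op (p t) g) (kernel_op (p t) g) <= K * expR (- (beta * t))) ->
  mean_decay p beta.
Proof.
move=> pip semi dual p0 bounded t u t0 hu u0.
rewrite -l2norm_le_expR; apply: (kernel_op_decay_dense pi1) => //.
  by move=> B; exact: pip.
move=> e e0; have [g [M [mg gM g0 ug]]] := bounded_dense pi1 hu u0 e0.
have hg := bounded_l2 pi1 mg gM.
exists g; split=> //; rewrite l2norm_le_expR.
have [K hK] := bounded g M mg gM g0.
have hKg s : 0 <= s -> real_l2 pi (kernel_op (p s) g).
  by move=> s0; apply: kernel_op_l2 hg => B; exact: pip.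
have e00 : ip pi g g = ip pi (kernel_op (p 0) g) (kernel_op (p 0) g).
  by congr (ip pi _ _); apply/funext => x; rewrite p0.
rewrite e00.
apply: (log_convex_decay (h := fun s => ip pi (kernel_op (p s) g) (kernel_op (p s) g))
  _ _ hK t0).
- by move=> s _; exact: ip_ge0.
- move=> s s0; rewrite -e00 mulrC.
  have -> : 2 * s = s + s by ring.
  have hKK : real_l2 pi (kernel_op (p s) (kernel_op (p s) g)).
    by apply: kernel_op_l2 (hKg s s0) => B; exact: pip.
  have hss : real_l2 pi (kernel_op (p (s + s)) g) by apply: hKg; rewrite addr_ge0.
  rewrite (dual_kernels_ip pi1 (dual s s0) (hKg s s0) hg).
  rewrite ipC -(ip_ae hss.1 hKK.1 hg.1 (semi s s g s0 s0 hg)) ipC.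
  exact: cauchy_schwarz_sqr.
Qed.

(** Here [p], [q], [r] are the families of X, X* and Xo. Invariance of [D] holds up to null sets, so
    at time [s] the proof works with a representative [g] in [D] of P_s f; [kernel_op_ae] carries
    the equality to later times. *)
Lemma generator_mean_decay p q r (D : set (T -> R)) (beta : R) : 0 <= beta ->
  invariant_family p -> semigroup_family p ->
  (forall u x, measurable_fun setT u -> kernel_op (p 0) u x = u x) ->
  (forall t, 0 <= t -> dual_kernels pi (p t) (q t)) ->
  invariant_family r -> mean_decay r beta ->
  (forall u, real_l2 pi u -> \int[pi]_x u x = 0 -> forall e, 0 < e ->
    exists g, [/\ D g, real_l2 pi g, \int[pi]_x g x = 0 &
      l2norm pi (fun x => u x - g x) <= e]) ->
  (forall t u, 0 <= t -> D u ->
     exists2 g, D g & {ae pi, forall x, g x = kernel_op (p t) u x}) ->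
  (forall u, D u -> exists a a' ao, [/\ generator_at p u a,
     generator_at q u a', generator_at r u ao &
     {ae pi, forall x, ao x = 2^-1 * (a x + a' x)}]) ->
  mean_decay p beta.
Proof.
move=> b0 pip semi p0 pq pir decr dense invD genD t u t0 hu u0.
rewrite -l2norm_le_expR; apply: (kernel_op_decay_dense pi1) => //.
  by move=> B; exact: pip.
move=> e /(dense u hu u0)[f [Df hf f0 uf]]; exists f; split=> //.
rewrite l2norm_le_expR.
have piq : invariant_family q.
  by move=> s B s0 mB; exact: (dual_kernels_invariant_r (pq s s0)).
have hKf s : 0 <= s -> real_l2 pi (kernel_op (p s) f).
  by move=> s0; apply: kernel_op_l2 hf => B; exact: pip.
have -> : ip pi f f = ip pi (kernel_op (p 0) f) (kernel_op (p 0) f).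
  by congr (ip pi _ _); apply/funext => x; rewrite p0//; exact: hf.1.
apply: (right_differential_decay
  (h := fun s => ip pi (kernel_op (p s) f) (kernel_op (p s) f)) b0 _ _ _ t0).
- by move=> s _; exact: ip_ge0.
- move=> s r0 s0 r00.
  have r1 : 0 <= s + r0 by rewrite addr_ge0.
  have hKK : real_l2 pi (kernel_op (p r0) (kernel_op (p s) f)).
    by apply: kernel_op_l2 (hKf s s0) => B; exact: pip.
  have ae : {ae pi, forall x,
      kernel_op (p (s + r0)) f x = kernel_op (p r0) (kernel_op (p s) f) x}.
    by rewrite addrC; exact: semi.
  rewrite (nsq_ae (hKf _ r1).1 hKK.1 ae).
  by apply: kernel_op_contraction (hKf s s0) => B; exact: pip.
- move=> s eps s0 eps0; have [g Dg gK] := invD s f s0 Df.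
  have [a [a' [ao [ga ga' gao aoE]]]] := genD g Dg.
  have hg : real_l2 pi g by case: ga.
  have ha : real_l2 pi a by case: ga.
  have ha' : real_l2 pi a' by case: ga'.
  have hao : real_l2 pi ao by case: gao.
  have g0 : \int[pi]_x g x = 0.
    rewrite (ae_eq_measurable_Rintegral hg.1 (hKf s s0).1 gK).
    by rewrite (kernel_op_mean pi1)// => B; exact: pip.
  have aE : ip pi ao g = ip pi a g.
    have haa := l2D ha ha'.
    rewrite (ip_ae hao.1 (l2Z 2^-1 haa).1 hg.1 aoE) ipZl// ipDl//.
    by rewrite -(generator_dual_ip pip piq pq ga ga'); field.
  have dis : 2 * ip pi ao g <= - beta * ip pi g g.
    by apply: (generator_dissipative pir gao b0) => r0 r00; exact: decr.
  have [delta d0 hd] := generator_nsq_le pip ga eps0.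
  exists delta => // r0 rd; have /andP[r00 _] := rd; have r00' := ltW r00.
  have r1 : 0 <= s + r0 by rewrite addr_ge0.
  have hKg : real_l2 pi (kernel_op (p r0) g).
    by apply: kernel_op_l2 hg => B; exact: pip.
  have ae : {ae pi, forall x, kernel_op (p (s + r0)) f x = kernel_op (p r0) g x}.
    have h1 := kernel_op_ae (k := p r0) (fun B => pip r0 B r00') hg.1 (hKf s s0).1 gK.
    have h2 := semi r0 s f r00' s0 hf.
    by rewrite addrC; apply: filterS2 h1 h2 => x -> ->.
  rewrite (nsq_ae (hKf _ r1).1 hKg.1 ae) -(nsq_ae hg.1 (hKf s s0).1 gK).
  apply: le_trans (hd r0 rd) _.
  have := ler_wpM2l r00' dis; rewrite aE; lra.
Qed.

End semigroup_generator.

(** * Markov processes and couplings *)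

Section integral_extra.
Context {d} {T : measurableType d} {R : realType}.
Local Open Scope ereal_scope.
Import HBNNSimple.

(* For non-measurable [g] the integral is the lower integral. *)
Lemma ge0_le_lower_integral (mu : {measure set T -> \bar R}) (f g : T -> \bar R) :
  (forall x, 0 <= f x) -> (forall x, f x <= g x) ->
  \int[mu]_x f x <= \int[mu]_x g x.
Proof.
move=> f0 fg; have g0 x : 0 <= g x by exact: le_trans (f0 x) (fg x).
rewrite !ge0_integralTE//; apply: le_ereal_sup => _ [h hf <-].
by exists h => // x; exact: le_trans (hf x) (fg x).
Qed.

Lemma ge0_integral_law {d'} {Omega : measurableType d'}
    (P : {measure set Omega -> \bar R}) (Z : Omega -> T)
    (mu : {measure set T -> \bar R}) (A : set T) (f : T -> \bar R) :
  measurable_fun setT Z ->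
  (forall B, measurable B -> P (Z @^-1` B) = mu B) -> measurable A ->
  nng_measurable f ->
  \int[P]_(w in Z @^-1` A) f (Z w) = \int[mu]_(x in A) f x.
Proof.
move=> mZ PZ mA [mf f0].
transitivity (\int[pushforward P Z]_(x in A) f x).
  rewrite ge0_integral_pushforward//; first exact: measurable_funTS.
apply: eq_measure_integral => B mB _; exact: PZ.
Qed.

Lemma Rintegral_law {d'} {Omega : measurableType d'}
    (P : {measure set Omega -> \bar R}) (Z : Omega -> T)
    (mu : {measure set T -> \bar R}) (u : T -> R) :
  measurable_fun setT Z ->
  (forall B, measurable B -> P (Z @^-1` B) = mu B) ->
  measurable_fun setT u ->
  (\int[P]_w u (Z w) = \int[mu]_x u x)%R.
Proof.
move=> mZ PZ mu_; have m1 : measurable_fun setT (EFin \o u).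
  exact/measurable_EFinP.
rewrite /Rintegral [in LHS]integralE [in RHS]integralE; congr (fine (_ - _)).
- have := @ge0_integral_law _ _ P Z mu setT (EFin \o u)^\+ mZ PZ measurableT.
  rewrite preimage_setT => <-; last by split=> //; exact: measurable_funepos.
  by apply: eq_integral => w _; rewrite -/((_ \o Z) w) -funepos_comp.
- have := @ge0_integral_law _ _ P Z mu setT (EFin \o u)^\- mZ PZ measurableT.
  rewrite preimage_setT => <-; last by split=> //; exact: measurable_funeneg.
  by apply: eq_integral => w _; rewrite -/((_ \o Z) w) -funeneg_comp.
Qed.

End integral_extra.

Section processes.
Context {R : realType} {S : pmetricType R}.
Implicit Types (Y : markov_process S) (A B : set (borel S)).
Implicit Types (pi mu : probability (borel S) R).

Lemma history_preimage {d} {Omega : measurableType d} (I : set R)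
    (Z : R -> Omega -> borel S) (s : R) A : I s -> measurable A ->
  history I Z s (Z s @^-1` A).
Proof. by move=> Is mA; apply: sub_sigma_algebra; exists s, A; split. Qed.

Lemma markov_wrt_joint {d} {Omega : measurableType d}
    (P : {measure set Omega -> \bar R}) (I : set R) (Z : R -> Omega -> borel S)
    (p : R -> R.-pker (borel S) ~> (borel S))
    (mu : {measure set (borel S) -> \bar R}) (s t : R) A B :
  markov_wrt I P Z p -> I s -> 0 <= t -> measurable_fun setT (Z s) ->
  (forall D, measurable D -> P (Z s @^-1` D) = mu D) ->
  measurable A -> measurable B ->
  P (Z s @^-1` A `&` Z (s + t) @^-1` B) = (\int[mu]_(x in A) p t x B)%E.
Proof.
move=> mk Is t0 mZ PZ mA mB; rewrite (mk s t _ _ Is t0 _ mB).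
  by rewrite (ge0_integral_law mZ PZ mA (kernel_nng (p t) mB)).
exact: history_preimage.
Qed.

Lemma mp_law_joint Y x t A B : 0 <= t -> measurable A -> measurable B ->
  mp_law Y x (@mp_path _ _ Y 0 @^-1` A `&` @mp_path _ _ Y t @^-1` B) =
  ((\1_A x)%:E * mp_tf Y t x B)%E.
Proof.
move=> t0 mA mB; rewrite -[X in @mp_path _ _ _ X @^-1` B](add0r t).
have mZ : measurable_fun setT (@mp_path _ _ Y 0).
  by apply: mp_is_process; rewrite /nonneg_times /=.
rewrite (markov_wrt_joint (mu := \d_x) (mp_markov (m:=Y) x) _ t0 mZ _ mA mB).
- rewrite integral_mkcond epatch_indic integral_dirac//.
    by rewrite diracT mul1e muleC.
  apply: emeasurable_funM; first exact: (kernel_nng _ mB).1.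
  exact/measurable_EFinP/measurable_indic.
- by rewrite /nonneg_times /=.
- by move=> D mD; exact: mp_start.
Qed.

Lemma path_measurable_coord t B : 0 <= t -> measurable B ->
  path_measurable [set z : R -> S | B (z t)].
Proof. by move=> t0 mB; apply: sub_sigma_algebra; exists t, B; split. Qed.

Lemma path_measurable_joint s t A B : 0 <= s -> 0 <= t ->
  measurable A -> measurable B ->
  path_measurable ([set z : R -> S | A (z s)] `&` [set z | B (z t)]).
Proof.
move=> s0 t0 mA mB.
exact: (@measurableI _ (g_sigma_algebraType
  [set E : set (R -> S) | exists t (B : set (borel S)),
     [/\ 0 <= t, measurable B & E = [set z | B (z t)]]]) _ _
  (path_measurable_coord s0 mA) (path_measurable_coord t0 mB)).
Qed.

Lemma has_law_joint Y mu {d} {Omega : measurableType d} (P : probability Omega R)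
    (Z : R -> Omega -> borel S) t A B : has_law_from Y mu P Z ->
  0 <= t -> measurable A -> measurable B ->
  P (Z 0 @^-1` A `&` Z t @^-1` B) = (\int[mu]_(x in A) mp_tf Y t x B)%E.
Proof.
move=> [_ law] t0 mA mB.
have := law _ (path_measurable_joint (lexx 0) t0 mA mB).
rewrite (_ : [set w | _] = Z 0 @^-1` A `&` Z t @^-1` B)// => ->.
rewrite [RHS]integral_mkcond epatch_indic; apply: eq_integral => x _.
rewrite muleC -mp_law_joint//.
Qed.

Lemma has_law_marginal Y mu {d} {Omega : measurableType d} (P : probability Omega R)
    (Z : R -> Omega -> borel S) t B : has_law_from Y mu P Z ->
  0 <= t -> measurable B ->
  P (Z t @^-1` B) = (\int[mu]_x mp_tf Y t x B)%E.
Proof.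
move=> law t0 mB; rewrite -(has_law_joint law t0 measurableT mB).
by rewrite preimage_setT setTI.
Qed.

Lemma stationary_marginal Y pi (V : stationary_version Y pi) t B :
  measurable B -> sv_prob V (@sv_path _ _ _ _ V t @^-1` B) = pi B.
Proof.
move=> mB; rewrite -(sv_initial V mB).
have := @sv_stationary _ _ _ _ V t _ (path_measurable_coord (lexx 0) mB).
by rewrite /= addr0.
Qed.

(** The dual path at 0 and [t] is the stationary path at 0 and [- t], so the Markov property is
    applied from time [- t] on, with the roles of [A] and [B] exchanged. *)
Lemma stationary_dual_joint Y pi (V : stationary_version Y pi) t A B : 0 <= t ->
  measurable A -> measurable B ->
  sv_prob V (dual_path (V:=V) 0 @^-1` A `&` dual_path (V:=V) t @^-1` B) =
  (\int[pi]_(x in B) mp_tf Y t x A)%E.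
Proof.
move=> t0 mA mB.
have mZ : measurable_fun setT (@sv_path _ _ _ _ V (- t)) by exact: sv_is_process.
rewrite -(markov_wrt_joint (mu := pi) (s := - t) (@sv_markov _ _ _ _ V)
  Logic.I t0 mZ _ mB mA).
  by rewrite addNr setIC /dual_path oppr0.
by move=> D mD; exact: stationary_marginal.
Qed.

(** The law of the dual path at the times 0 and [t] is computed twice: forwards, as that of Y
    started from [pi], and backwards along the stationary path. *)
Lemma reversible_dual_kernels Y pi t : time_reversible Y pi -> 0 <= t ->
  dual_kernels pi (mp_tf Y t) (mp_tf Y t).
Proof.
move=> [V law] t0 A B mA mB.
by rewrite -(has_law_joint law t0 mA mB) (stationary_dual_joint V t0 mA mB).
Qed.

Lemma dual_transition_dual_kernels Y pi (V : stationary_version Y pi)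
    (q : R -> R.-pker (borel S) ~> (borel S)) t :
  dual_transition V q -> 0 <= t -> dual_kernels pi (mp_tf Y t) (q t).
Proof.
move=> Vq t0 A B mA mB; rewrite -(stationary_dual_joint V t0 mA mB).
have mZ : measurable_fun setT (dual_path (V:=V) 0) by exact: sv_is_process.
rewrite -[X in dual_path X @^-1` B]add0r.
rewrite (markov_wrt_joint (mu := pi) Vq _ t0 mZ _ mA mB)//.
- by rewrite /nonneg_times /=.
- by move=> D mD; rewrite /dual_path; exact: stationary_marginal.
Qed.

Lemma mp_tf_semigroup Y pi : invariant_measure Y pi ->
  semigroup_family pi (mp_tf Y).
Proof.
move=> inv s t u s0 t0 hu.
have pi1 : (pi : {measure set _ -> \bar R}) setT = 1%E := probability_setT pi.
have st0 : 0 <= s + t by rewrite addr_ge0.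
apply: filterS (kernel_comp_ae_integrable (fun B => inv _ B st0)
  (l2_integrable pi1 hu)) => x iu.
rewrite {1}/kernel_op (kernel_comp_Rintegral (mu := mp_tf Y s x) (k := mp_tf Y t))//.
by move=> B mB; rewrite -mp_chapman_kolmogorov.
Qed.

Lemma mp_tf0_op Y u x : measurable_fun setT u -> kernel_op (mp_tf Y 0) u x = u x.
Proof.
move=> mu_; rewrite /kernel_op /Rintegral.
rewrite (eq_measure_integral (\d_x : {measure set _ -> \bar R})); last first.
  by move=> A mA _; exact: mp_tf0.
rewrite integral_dirac//; last exact/measurable_EFinP.
by rewrite diracT mul1e.
Qed.

End processes.

(** * From a coupling to exponential decay *)

Section coupling.
Context {R : realType} {S : pmetricType R}.
Implicit Types (Y : markov_process S) (pi : probability (borel S) R).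

(** The difference g(Z1) - g(Z2) vanishes where the components agree; elsewhere it is at most 2 M <=
    M (phi(Z1) + phi(Z2)), because phi >= 1. *)
Lemma coupling_kernel_op_le Y (phi : borel S -> R) (C beta M : R)
    (pi' : probability (borel S) R) (x : borel S)
    {d} {Omega : measurableType d} (P : probability Omega R)
    (Z1 Z2 : R -> Omega -> borel S) (g : borel S -> R) t :
  (forall y, 1 <= phi y) -> invariant_measure Y pi' ->
  coupling Y (\d_x : probability (borel S) R) pi' P Z1 Z2 ->
  (\int[P]_w ((phi (Z1 t w) + phi (Z2 t w)) *
              \1_[set w | Z1 t w <> Z2 t w] w)%:E
     <= (C * expR (- (beta * t)) * phi x)%:E)%E ->
  0 <= t -> 0 < M -> measurable_fun setT g -> (forall y, `|g y| <= M) ->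
  `|kernel_op (mp_tf Y t) g x - \int[pi']_y g y| <=
  M * (C * expR (- (beta * t)) * phi x).
Proof.
move=> phi1 inv [law1 law2] cpl t0 M0 mg gM.
have P1 : (P : {measure set _ -> \bar R}) setT = 1%E := probability_setT P.
have mZ1 : measurable_fun setT (Z1 t) by exact: law1.1.
have mZ2 : measurable_fun setT (Z2 t) by exact: law2.1.
have L1 : \int[P]_w g (Z1 t w) = kernel_op (mp_tf Y t) g x.
  apply: (Rintegral_law (mu := mp_tf Y t x)) => // B mB.
  apply: (etrans (has_law_marginal law1 t0 mB)); rewrite integral_dirac//.
    by rewrite diracT mul1e.
  exact: (kernel_nng _ mB).1.
have L2 : \int[P]_w g (Z2 t w) = \int[pi']_y g y.
  apply: (Rintegral_law (mu := pi')) => // B mB.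
  by apply: (etrans (has_law_marginal law2 t0 mB)); exact: inv.
have i1 : P.-integrable setT (EFin \o (fun w => g (Z1 t w))).
  apply: (l2_integrable P1); apply: (bounded_l2 (M := M) P1) => //.
  exact: measurableT_comp.
have i2 : P.-integrable setT (EFin \o (fun w => g (Z2 t w))).
  apply: (l2_integrable P1); apply: (bounded_l2 (M := M) P1) => //.
  exact: measurableT_comp.
have iB : P.-integrable setT (EFin \o (fun w => g (Z1 t w) - g (Z2 t w))).
  exact: (integrableB measurableT i1 i2).
rewrite -L1 -L2 -RintegralB//.
apply: le_trans (le_normr_Rintegral measurableT iB) _.
(* [M] is moved to the measurable left side, so that the right side is the coupling integral itself,
   possibly only a lower integral; the comparison below needs measurability of neither integrand. *)
rewrite -ler_pdivrMl// -RintegralZl//; last exact: integrable_norm iB.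
rewrite -lee_fin /Rintegral fineK; last first.
  apply: integrable_fin_num => //.
  have := integrableZl measurableT M^-1 (integrable_norm iB).
  exact.
apply: le_trans cpl; apply: ge0_le_lower_integral => w; rewrite lee_fin.
  by rewrite mulr_ge0 ?invr_ge0 ?(ltW M0).
rewrite ler_pdivrMl// indicE.
have [Z12|/eqP Z12] := eqVneq (Z1 t w) (Z2 t w).
  rewrite Z12 subrr normr0; apply: mulr_ge0 (ltW M0) _; apply: mulr_ge0 => //.
  by apply: addr_ge0; exact: le_trans ler01 (phi1 _).
rewrite mem_set// mulr1; apply: le_trans (ler_normB _ _) _.
have := gM (Z1 t w); have := gM (Z2 t w).
have := phi1 (Z1 t w); have := phi1 (Z2 t w); nra.
Qed.

(** The coupling compares P_t g with its mean c under its own invariant measure [pi'], not under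
    [pi]. Integrating that comparison against [pi], where P_t g has mean zero, bounds |c| by the
    same exponential. *)
Lemma coupling_bounded_decay Y pi (phi : borel S -> R) (C beta : R) :
  measurable_fun setT phi -> (forall x, 1 <= phi x) ->
  pi.-integrable setT (fun x => (phi x)%:E) ->
  exponential_coupling Y phi C beta -> invariant_measure Y pi ->
  forall (g : borel S -> R) (M : R), measurable_fun setT g -> (forall x, `|g x| <= M) ->
  \int[pi]_x g x = 0 -> exists K, forall t, 0 <= t ->
  ip pi (kernel_op (mp_tf Y t) g) (kernel_op (mp_tf Y t) g) <=
  K * expR (- (beta * t)).
Proof.
move=> mphi phi1 iphi [C0 b0 [pi' inv' cpl]] inv g M0 mg gM0 g0.
have pi1 : (pi : {measure set _ -> \bar R}) setT = 1%E := probability_setT pi.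
pose M := M0 + 1.
have M0_ge0 : 0 <= M0 by exact: le_trans (normr_ge0 _) (gM0 point).
have M_gt0 : 0 < M by rewrite /M; lra.
have gM x : `|g x| <= M by apply: le_trans (gM0 x) _; rewrite /M; lra.
have hg := bounded_l2 pi1 mg gM.
pose m := \int[pi]_x phi x.
(* One [M] is the sup bound on P_t g; the rest is the integral of A phi + A m, that is 2 A m, with A
   = M C e^{- beta t}. *)
exists (M * (M * C * (2 * m))) => t t0.
pose c := \int[pi']_y g y; pose A := M * (C * expR (- (beta * t))).
have A0 : 0 <= A by rewrite /A !mulr_ge0 ?expR_ge0 ?(ltW M_gt0) ?(ltW C0).
have key x : `|kernel_op (mp_tf Y t) g x - c| <= A * phi x.
  have [d [W [P [Z1 [Z2 [cp hle]]]]]] := cpl x; have {}hle := hle t t0.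
  by rewrite /A -mulrA; exact: (coupling_kernel_op_le phi1 inv' cp hle t0 M_gt0 mg gM).
have invt B : measurable B -> (\int[pi]_x mp_tf Y t x B = pi B)%E by exact: inv.
have hK := kernel_op_l2 invt hg; have iK := l2_integrable pi1 hK.
have hKc := l2B hK (l2_cst pi1 c); have iKc := l2_integrable pi1 hKc.
have iAphi : pi.-integrable setT (EFin \o (fun x => A * phi x)).
  by have := integrableZl measurableT A iphi.
have IAphi : \int[pi]_x (A * phi x) = A * m by rewrite RintegralZl.
have cm : `|c| <= A * m.
  have -> : c = - \int[pi]_x (kernel_op (mp_tf Y t) g x - c).
    rewrite RintegralB//; last exact: (l2_integrable pi1 (l2_cst pi1 c)).
    by rewrite (kernel_op_mean pi1 invt hg) g0 (Rintegral_probability_cst pi1); ring.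
  rewrite normrN; apply: le_trans (le_normr_Rintegral measurableT iKc) _.
  by rewrite -IAphi; apply: le_Rintegral => //; exact: integrable_norm.
have iAm : pi.-integrable setT (EFin \o (fun x => A * phi x + A * m)).
  exact: (integrableD measurableT iAphi (l2_integrable pi1 (l2_cst pi1 (A * m)))).
have K_le x : `|kernel_op (mp_tf Y t) g x| <= A * phi x + A * m.
  rewrite -[X in `|X|](subrK c); apply: le_trans (ler_normD _ _) _.
  exact: lerD.
have KM := kernel_op_bounded (mp_tf Y t) mg gM.
rewrite (_ : M * (M * C * (2 * m)) * expR (- (beta * t)) =
  M * (A * m + A * m)); last by rewrite /A; ring.
have -> : M * (A * m + A * m) = \int[pi]_x (M * (A * phi x + A * m)).
  rewrite RintegralZl// RintegralD//.
    by rewrite IAphi (Rintegral_probability_cst pi1).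
  exact: (l2_integrable pi1 (l2_cst pi1 (A * m))).
apply: le_Rintegral => //.
- exact: (l2_mul_integrable hK hK).
- by have := integrableZl measurableT M iAm.
- move=> x _; apply: le_trans (ler_norm _) _; rewrite normrM.
  by apply: ler_pM.
Qed.

Lemma reversible_coupling_decay Y pi (phi : borel S -> R) (C beta : R) :
  measurable_fun setT phi -> (forall x, 1 <= phi x) ->
  pi.-integrable setT (fun x => (phi x)%:E) ->
  exponential_coupling Y phi C beta -> invariant_measure Y pi ->
  time_reversible Y pi -> mean_decay pi (mp_tf Y) beta.
Proof.
move=> mphi phi1 iphi cpl inv rev.
apply: (reversible_mean_decay (probability_setT pi)).
- by move=> t B t0 mB; exact: inv.
- exact: mp_tf_semigroup.
- by move=> t t0; exact: reversible_dual_kernels.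
- by move=> u x mu_; exact: mp_tf0_op.
- exact: (coupling_bounded_decay mphi phi1 iphi cpl inv).
Qed.

End coupling.

(** * The complex space L_2 *)

Section complex_L2.
Context {R : realType} {d : measure_display} {T : measurableType d}.
Variables (mu : {measure set T -> \bar R}).
Implicit Types f g : T -> R[i].

Local Notation re f := (fun x => complex.Re (f x)).
Local Notation im f := (fun x => complex.Im (f x)).

Lemma L2norm_sqr f : measurable_fun setT (re f) -> measurable_fun setT (im f) ->
  (L2norm mu f `^ 2)%E =
  (\int[mu]_x ((complex.Re (f x)) ^+ 2)%:E +
   \int[mu]_x ((complex.Im (f x)) ^+ 2)%:E)%E.
Proof.
move=> mre mim; rewrite /L2norm powR_Lnorm// -ge0_integralD//=.
- apply: eq_integral => x _.
  have r0 : 0 <= complex.Re (f x) ^+ 2 + complex.Im (f x) ^+ 2.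
    by rewrite addr_ge0 ?sqr_ge0.
  case: (f x) r0 => a b /= r0.
  by rewrite ger0_norm ?sqrtr_ge0// powR_mulrn ?sqrtr_ge0// sqr_sqrtr.
- by move=> x _; rewrite lee_fin sqr_ge0.
- by apply/measurable_EFinP; exact: measurable_funX.
- by move=> x _; rewrite lee_fin sqr_ge0.
- by apply/measurable_EFinP; exact: measurable_funX.
Qed.

Lemma L2_real_l2 f : L2 mu f <-> real_l2 mu (re f) /\ real_l2 mu (im f).
Proof.
have sq0 (u : T -> R) : (0 <= \int[mu]_x (u x ^+ 2)%:E)%E.
  by apply: integral_ge0 => x _; rewrite lee_fin sqr_ge0.
have l2P (u : T -> R) : measurable_fun setT u ->
    (\int[mu]_x (u x ^+ 2)%:E < +oo)%E <-> real_l2 mu u.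
  move=> mu_; have E : (\int[mu]_x `|(u x ^+ 2)%:E| = \int[mu]_x (u x ^+ 2)%:E)%E.
    by apply: eq_integral => x _; rewrite gee0_abs// lee_fin sqr_ge0.
  split; last by move=> [_ /integrableP[_]]; rewrite E.
  move=> fin; split=> //; apply/integrableP; split; last by rewrite E.
  by apply/measurable_EFinP; exact: measurable_funX.
split.
- move=> [mre mim fin]; rewrite -!l2P//.
  have := poweR_lty 2 fin; rewrite L2norm_sqr// => fin2.
  by split; apply: le_lt_trans fin2; [exact: leeDl|exact: leeDr].
- move=> [hre him]; split; [exact: hre.1|exact: him.1|].
  apply: (@lty_poweRy _ _ 2); first by rewrite pnatr_eq0.
  rewrite (L2norm_sqr hre.1 him.1).
  by apply: lte_add_pinfty; apply/l2P => //; [exact: hre.1|exact: him.1].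
Qed.

Lemma L2norm_l2norm f : real_l2 mu (re f) -> real_l2 mu (im f) ->
  L2norm mu f = (Num.sqrt (l2norm mu (re f) ^+ 2 + l2norm mu (im f) ^+ 2))%:E.
Proof.
move=> hre him; have [_ _ fin] := (L2_real_l2 f).2 (conj hre him).
have := L2norm_sqr hre.1 him.1.
have ipE u : real_l2 mu u ->
    (\int[mu]_x (u x ^+ 2)%:E)%E = (l2norm mu u ^+ 2)%:E.
  move=> hu; rewrite l2norm_sqr /ip /Rintegral.
  under [in RHS]eq_integral do rewrite -expr2.
  by rewrite fineK//; exact: (integrable_fin_num measurableT hu.2).
rewrite !ipE//.
move: fin (Lnorm_ge0 mu 2%:E (fun x => (ComplexField.Normc.normc (f x))%:E)).
rewrite -/(L2norm mu f); case: (L2norm mu f) => [r| |]//= _; rewrite lee_fin => r0.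
rewrite powR_mulrn// => -[<-].
by rewrite sqrtr_sqr ger0_norm.
Qed.

(** Kernels and time are real, so the difference quotient splits into its real and imaginary parts,
    each with norm at most that of the whole. *)
Lemma L2_generator_at (p : R -> R.-pker T ~> T) f g :
  invariant_family mu p -> L2_generator mu p f g ->
  generator_at mu p (re f) (re g) /\ generator_at mu p (im f) (im g).
Proof.
move=> inv [hf hg lim].
have [href himf] := (L2_real_l2 f).1 hf; have [hreg himg] := (L2_real_l2 g).1 hg.
pose F s x : R[i] := (s^-1)%:C%C * (semigroup p s f x - f x) - g x.
have hquot s u a : 0 < s -> real_l2 mu u -> real_l2 mu a ->
    real_l2 mu (fun x => s^-1 * (kernel_op (p s) u x - u x) - a x).
  move=> s0 hu ha; apply: l2B => //; apply: l2Z; apply: l2B => //.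
  by apply: kernel_op_l2 hu => B; apply: inv; exact: ltW.
have reF s : re (F s) = (fun x =>
    s^-1 * (kernel_op (p s) (re f) x - complex.Re (f x)) - complex.Re (g x)).
  apply/funext => x; rewrite /F /semigroup /cintegral /kernel_op.
  by case: (f x) (g x) => a b [a' b'] /=; rewrite mul0r subr0.
have imF s : im (F s) = (fun x =>
    s^-1 * (kernel_op (p s) (im f) x - complex.Im (f x)) - complex.Im (g x)).
  apply/funext => x; rewrite /F /semigroup /cintegral /kernel_op.
  by case: (f x) (g x) => a b [a' b'] /=; rewrite mul0r addr0.
have small e : 0 < e -> exists2 delta, 0 < delta & forall s, 0 < s < delta ->
    l2norm mu (re (F s)) <= e /\ l2norm mu (im (F s)) <= e.
  move=> e0; have := cvgr_lt _ (fine_cvg lim) _ e0.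
  move=> [delta /= d0 hd]; exists delta => // s /andP[s0 sd].
  have := hd s; rewrite /ball_/= sub0r normrN gtr0_norm// => /(_ sd s0).
  rewrite -/(F s) L2norm_l2norm/=; last 2 first.
  - by rewrite reF; exact: hquot.
  - by rewrite imF; exact: hquot.
  move=> /ltW h; split; apply: le_trans h.
    rewrite -[leLHS]ger0_norm ?l2norm_ge0// -sqrtr_sqr ler_sqrt ?lerDl ?sqr_ge0//.
    by rewrite addr_ge0 ?sqr_ge0.
  rewrite -[leLHS]ger0_norm ?l2norm_ge0// -sqrtr_sqr ler_sqrt ?lerDr ?sqr_ge0//.
  by rewrite addr_ge0 ?sqr_ge0.
split; split=> // e /small[delta d0 hd]; exists delta => // s /hd[].
  by rewrite reF.
by rewrite imF.
Qed.

End complex_L2.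

(** * Reduction of the complex statement to real and imaginary parts *)

Theorem theorem3p4 (R : realType) (S : pmetricType R)
  (hS : locally_compact [set: S])
  (X Xo : markov_process S)
  (phi0 phi : borel S -> R) (C0 beta0 C beta : R)
  (pi : probability (borel S) R)
  (hphi0 : measurable_fun setT phi0) (hphi0_ge1 : forall x, 1 <= phi0 x)
  (hX : exponential_coupling X phi0 C0 beta0)
  (hpi : invariant_measure X pi)
  (hphi0_L1 : pi.-integrable setT (fun x => (phi0 x)%:E))
  (hpio : invariant_measure Xo pi) (hrev : time_reversible Xo pi)
  (hphi : measurable_fun setT phi) (hphi_ge1 : forall x, 1 <= phi x)
  (hXo : exponential_coupling Xo phi C beta)
  (hphi_L1 : pi.-integrable setT (fun x => (phi x)%:E))
  (V : stationary_version X pi)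
  (pstar : R -> R.-pker (borel S) ~> (borel S))
  (hpstar : dual_transition V pstar)
  (D : set (borel S -> R[i])) (hD : D `<=` L2 pi)
  (D_dense : forall f, L20 pi f -> forall e : R, 0 < e ->
     exists g, [/\ D g, L20 pi g & (L2norm pi (fun x => f x - g x)%R < e%:E)%E])
  (D_inv : forall (t : R) f, 0 <= t -> D f ->
     exists2 g, D g & {ae pi, forall x, g x = semigroup (mp_tf X) t f x})
  (D_gen : forall f, D f -> exists Af Asf Aof : borel S -> R[i],
     [/\ L2_generator pi (mp_tf X) f Af,
         L2_generator pi pstar f Asf,
         L2_generator pi (mp_tf Xo) f Aof &
         {ae pi, forall x, Aof x = 2^-1 * (Af x + Asf x)}]) :
  PI pi (mp_tf X) (beta / 2).
Proof.
have pi1 : (pi : {measure set _ -> \bar R}) setT = 1%E := probability_setT pi.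
have inv (Y : markov_process S) : invariant_measure Y pi ->
    invariant_family pi (mp_tf Y).
  by move=> h t B t0 mB; exact: h.
have dual t (t0 : 0 <= t) := dual_transition_dual_kernels hpstar t0.
have invs : invariant_family pi pstar.
  by move=> t B t0 mB; exact: (dual_kernels_invariant_r (dual t t0)).
have decXo := reversible_coupling_decay hphi hphi_ge1 hphi_L1 hXo hpio hrev.
have [_ /ltW beta_ge0 _] := hXo.
(* Real and imaginary parts are put into one set as separate elements, so that [DR] inherits
   invariance and the generator identity one component at a time. *)
pose DR : set (borel S -> R) := [set u | exists2 f, D f &
  u = (fun x => complex.Re (f x)) \/ u = (fun x => complex.Im (f x))].
have decX : mean_decay pi (mp_tf X) beta.
  apply: (generator_mean_decay pi1 (q := pstar) (r := mp_tf Xo) (D := DR)) => //.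
  - exact: mp_tf_semigroup.
  - by move=> u x mu_; exact: mp_tf0_op.
  (* A real [u] is approximated in the complex space; the real part of the approximant lies in [DR]
     and is at least as close to [u]. *)
  - move=> u hu u0 e e0; pose f x : R[i] := Complex (u x) 0.
    have z0 : real_l2 pi (fun=> 0) by exact: l2_cst.
    have hf : L20 pi f.
      split; first exact/L2_real_l2.
      by rewrite /cintegral /= u0 (Rintegral_probability_cst pi1).
    have [g [Dg [hg g0] fg]] := D_dense f hf e e0.
    have [hreg himg] := (L2_real_l2 pi g).1 hg.
    exists (fun x => complex.Re (g x)); split=> //.
    + by exists g => //; left.
    + by case: g0.
    have reE : (fun x => complex.Re (f x - g x)) = (fun x => u x - complex.Re (g x)).
      by apply/funext => x; rewrite /f; case: (g x).
    have imE : (fun x => complex.Im (f x - g x)) = (fun x => 0 - complex.Im (g x)).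
      by apply/funext => x; rewrite /f; case: (g x).
    have hre := l2B hu hreg; have him := l2B z0 himg.
    move: fg; rewrite L2norm_l2norm ?reE ?imE//= lte_fin => /ltW; apply: le_trans.
    rewrite -[leLHS]ger0_norm ?l2norm_ge0// -sqrtr_sqr ler_sqrt ?lerDl ?sqr_ge0//.
    by rewrite addr_ge0 ?sqr_ge0.
  - move=> t _ t0 [f Df [->|->]]; have [g Dg gE] := D_inv t f t0 Df.
      exists (fun x => complex.Re (g x)); first by exists g => //; left.
      by apply: filterS gE => x ->.
    exists (fun x => complex.Im (g x)); first by exists g => //; right.
    by apply: filterS gE => x ->.
  - have half (z w : R[i]) : complex.Re (2^-1 * (z + w)) =
        2^-1 * (complex.Re z + complex.Re w) /\
      complex.Im (2^-1 * (z + w)) = 2^-1 * (complex.Im z + complex.Im w).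
      have -> : 2^-1 = (2^-1)%:C%C :> R[i] by rewrite fmorphV rmorph_nat.
      by case: z w => a b [a' b'] /=; rewrite !mul0r subr0 addr0.
    move=> u [f Df fE]; have [Af [Asf [Aof [gA gAs gAo AoE]]]] := D_gen f Df.
    have [gA1 gA2] := L2_generator_at (inv X hpi) gA.
    have [gAs1 gAs2] := L2_generator_at invs gAs.
    have [gAo1 gAo2] := L2_generator_at (inv Xo hpio) gAo.
    case: fE => ->.
      exists (fun x => complex.Re (Af x)), (fun x => complex.Re (Asf x)),
        (fun x => complex.Re (Aof x)); split=> //.
      by apply: filterS AoE => x ->; exact: (half _ _).1.
    exists (fun x => complex.Im (Af x)), (fun x => complex.Im (Asf x)),
      (fun x => complex.Im (Aof x)); split=> //.
    by apply: filterS AoE => x ->; exact: (half _ _).2.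
move=> t f t0 [hf [re0 im0]]; have [hre him] := (L2_real_l2 pi f).1 hf.
have hK u : real_l2 pi u -> real_l2 pi (kernel_op (mp_tf X t) u).
  by move=> hu; apply: kernel_op_l2 hu => B mB; exact: hpi.
rewrite !L2norm_l2norm//; [|exact: (hK _ hre)|exact: (hK _ him)].
(* The squared complex norm is the sum over the two parts, each of mean zero, so squaring turns the
   rate beta / 2 into the rate beta of [decX]. *)
rewrite -EFinM lee_fin -[X in X * _]ger0_norm ?expR_ge0// -sqrtr_sqr.
rewrite -sqrtrM ?sqr_ge0// ler_sqrt; last first.
  by rewrite mulr_ge0 ?addr_ge0 ?sqr_ge0.
have -> : expR (- (beta / 2 * t)) ^+ 2 = expR (- (beta * t)).
  by rewrite -expRM_natl; congr expR; field.
by rewrite mulrDr; apply: lerD; rewrite !l2norm_sqr; exact: decX.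
Qed.
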